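(* Let $\Omega\subset\mathbb{R}^n$ be an open set. (i) If $(f_\alpha)_{\alpha\in(0,1)}\subset L^1_{\rm loc}(\mathbb{R}^n)$ satisfies $\sup_{\alpha\in(0,1)}\|f_\alpha\|_{L^\infty(\mathbb{R}^n)}<+\infty$ and $f_\alpha\to f$ in $L^1_{\rm loc}(\mathbb{R}^n)$ as $\alpha\to1^-$, then $$|Df|(\Omega)\le\liminf_{\alpha\to1^-}|D^\alpha f_\alpha|(\Omega).$$ (ii) If $(f_\alpha)_{\alpha\in(0,1)}\subset L^1(\mathbb{R}^n)$ satisfies $f_\alpha\to f$ in $L^1(\mathbb{R}^n)$ as $\alpha\to1^-$, then $$|Df|(\Omega)\le\liminf_{\alpha\to1^-}|D^\alpha f_\alpha|(\Omega).$$
   Context: Here $n\in\mathbb{N}$, $n\ge1$. For $\alpha\in(0,1)$ let $\mu_{n,\alpha}:=2^\alpha\pi^{-n/2}\,\Gamma\big(\tfrac{n+\alpha+1}{2}\big)/\Gamma\big(\tfrac{1-\alpha}{2}\big)$, and for $\varphi\in C^\infty_c(\mathbb{R}^n;\mathbb{R}^n)$ let $$\mathrm{div}^\alpha\varphi(x):=\mu_{n,\alpha}\int_{\mathbb{R}^n}\frac{(y-x)\cdot(\varphi(y)-\varphi(x))}{|y-x|^{n+\alpha+1}}\,dy,\qquad x\in\mathbb{R}^n,$$ which belongs to $L^1(\mathbb{R}^n)\cap L^\infty(\mathbb{R}^n)$. For $g\in L^1(\mathbb{R}^n)$ or $g\in L^\infty(\mathbb{R}^n)$ and $\Omega\subset\mathbb{R}^n$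 open, $$|D^\alpha g|(\Omega):=\sup\Big\{\int_{\mathbb{R}^n} g\,\mathrm{div}^\alpha\varphi\,dx:\ \varphi\in C^\infty_c(\Omega;\mathbb{R}^n),\ \|\varphi\|_{L^\infty(\Omega;\mathbb{R}^n)}\le1\Big\}\in[0,+\infty].$$ $|Df|(\Omega)\in[0,+\infty]$ is the standard (De Giorgi) variation of $f$ in $\Omega$, i.e. the supremum of $\int f\,\mathrm{div}\varphi\,dx$ over the same class of $\varphi$. *)

(* Defs.v *)
From HB Require Import structures.
From mathcomp Require Import all_boot all_order all_algebra.
From mathcomp Require Import all_classical all_reals all_analysis.

Set Implicit Arguments.
Unset Strict Implicit.
Unset Printing Implicit Defensive.

Import Order.TTheory GRing.Theory Num.Theory.
Import numFieldNormedType.Exports.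

Local Open Scope classical_set_scope.
Local Open Scope ring_scope.

(* R^n is 'rV[R]_n. Its sigma-algebra is the product one, i.e. the Borel      *)
(* sigma-algebra of the library's topology on row vectors.                    *)

Definition measure_rV_display : measure_display.
Proof. exact: default_measure_display. Qed.

Section measurable_rV.
Context {R : realType} {n : nat}.

Let coord : 'I_n -> 'rV[R]_n -> R := fun i x => x ord0 i.

Let rV_set0 : g_sigma_preimage coord set0.
Proof. exact: sigma_algebra0. Qed.

Let rV_setC A : g_sigma_preimage coord A -> g_sigma_preimage coord (~` A).
Proof. exact: sigma_algebraC. Qed.

Let rV_bigcup (F : _^nat) : (forall i, g_sigma_preimage coord (F i)) ->
  g_sigma_preimage coord (\bigcup_i (F i)).
Proof. exact: sigma_algebra_bigcup. Qed.

HB.instance Definition _ := @isMeasurable.Build measure_rV_display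
  'rV[R]_n (g_sigma_preimage coord) rV_set0 rV_setC rV_bigcup.

End measurable_rV.

Lemma measurable_coord (R : realType) n (i : 'I_n) :
  measurable_fun [set: 'rV[R]_n] (fun x => x ord0 i).
Proof.
move=> _ Y mY; rewrite setTI; apply: sub_sigma_algebra => /=.
rewrite -bigcup_seq/=; exists i => /=; first by rewrite mem_index_enum.
by exists Y => //; rewrite setTI.
Qed.

Lemma measurable_fun_rV (R : realType) d (T : measurableType d) n
    (f : T -> 'rV[R]_n) :
  (forall i, measurable_fun [set: T] (fun t => f t ord0 i)) ->
  measurable_fun [set: T] f.
Proof.
move=> mf; suff : measurable `<=` image_set_system setT f measurable.
  by move=> h _ A mA; exact: h.
apply: smallest_sub.
  by apply: sigma_algebra_image; exact: sigma_algebra_measurable.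
rewrite -bigcup_seq/=; apply: bigcup_sub => i _ _ [B mB <-].
by rewrite /image_set_system/= !setTI -[X in measurable X]setTI; exact: mf.
Qed.

(* Lebesgue measure on R^n, by recursion on n: the Dirac mass on the point    *)
(* R^0, then the image of a product measure under R x R^n ~ R^(n+1).          *)

Section lebesgue_measure_rV.
Context {R : realType}.

Definition rV_cons n (p : measurableTypeR R * 'rV[R]_n) : 'rV[R]_n.+1 :=
  row_mx (const_mx p.1 : 'rV_1) p.2.

Definition rV_uncons n (x : 'rV[R]_n.+1) : measurableTypeR R * 'rV[R]_n :=
  (x ord0 ord0, \row_j x ord0 (lift ord0 j)).

Lemma rV_consE0 n (p : measurableTypeR R * 'rV[R]_n) : rV_cons p ord0 ord0 = p.1.
Proof.
have -> : @ord0 n = lshift n (@ord0 0) by exact/val_inj.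
by rewrite /rV_cons (row_mxEl (n1 := 1)) mxE.
Qed.

Lemma rV_consES n (p : measurableTypeR R * 'rV[R]_n) j :
  rV_cons p ord0 (lift ord0 j) = p.2 ord0 j.
Proof.
have -> : lift ord0 j = rshift 1 j by exact/val_inj.
by rewrite /rV_cons (row_mxEr (n1 := 1)).
Qed.

Lemma rV_consK n : cancel (@rV_cons n) (@rV_uncons n).
Proof.
move=> p; rewrite /rV_uncons rV_consE0 [RHS]surjective_pairing; congr pair.
by apply/rowP => j; rewrite mxE rV_consES.
Qed.

Lemma measurable_rV_cons n : measurable_fun setT (@rV_cons n).
Proof.
apply: measurable_fun_rV => i; case: (unliftP ord0 i) => [j|] ->.
  under eq_fun do rewrite rV_consES.
  exact: (measurableT_comp (measurable_coord j) measurable_snd).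
under eq_fun do rewrite rV_consE0.
exact: measurable_fst.
Qed.

Lemma measurable_rV_uncons n : measurable_fun setT (@rV_uncons n).
Proof.
apply: measurable_fun_pair; first exact: measurable_coord.
apply: measurable_fun_rV => i; under eq_fun do rewrite mxE.
exact: measurable_coord.
Qed.

Lemma rV_unconsK n : cancel (@rV_uncons n) (@rV_cons n).
Proof.
move=> x; apply/rowP => i; case: (unliftP ord0 i) => [j|] ->.
  by rewrite rV_consES mxE.
by rewrite rV_consE0.
Qed.

Section step.
Context n (mu : {sigma_finite_measure set 'rV[R]_n -> \bar R}).

Definition lebesgue_step : set 'rV[R]_n.+1 -> \bar R :=
  pushforward (lebesgue_measure \x mu)%E (@rV_cons n).

Let lebesgue_step0 : lebesgue_step set0 = 0%E.
Proof. by apply: measure0; exact: measurable_rV_cons. Qed.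

Let lebesgue_step_ge0 A : (0 <= lebesgue_step A)%E.
Proof. by apply: measure_ge0; exact: measurable_rV_cons. Qed.

Let lebesgue_step_sigma_additive : semi_sigma_additive lebesgue_step.
Proof. by apply: measure_semi_sigma_additive; exact: measurable_rV_cons. Qed.

HB.instance Definition _ := isMeasure.Build _ _ _ lebesgue_step
  lebesgue_step0 lebesgue_step_ge0 lebesgue_step_sigma_additive.

Lemma lebesgue_stepE (A : set (measurableTypeR R)) (B : set 'rV[R]_n) :
  measurable A -> measurable B ->
  (lebesgue_step (@rV_uncons n @^-1` (A `*` B)) = lebesgue_measure A * mu B)%E.
Proof.
move=> mA mB; rewrite /lebesgue_step /pushforward -comp_preimage.
rewrite -product_measure1E// (_ : _ \o _ = id) ?preimage_id//.
by apply/funext => x; exact: rV_consK.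
Qed.

Let lebesgue_step_sigma_finite : sigma_finite setT lebesgue_step.
Proof.
have /sigma_finiteP[F [TF ndF Foo]] :=
  sigma_finiteT (@lebesgue_measure R : {sigma_finite_measure set _ -> \bar R}).
have /sigma_finiteP[G [TG ndG Goo]] := sigma_finiteT mu.
exists (fun k => @rV_uncons n @^-1` (F k `*` G k)) => [|k].
  rewrite -preimage_bigcup (_ : \bigcup_i _ = setT) ?preimage_setT//.
  apply/seteqP; split => // -[x y] _.
  have [i _ Fx] : (\bigcup_i F i) x by rewrite -TF.
  have [j _ Gy] : (\bigcup_j G j) y by rewrite -TG.
  exists (maxn i j) => //; split => /=.
    by move: x Fx; exact/subsetPset/ndF/leq_maxl.
  by move: y Gy; exact/subsetPset/ndG/leq_maxr.
have [? ?] := Foo k; have [? ?] := Goo k; split.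
  rewrite -[X in measurable X]setTI.
  by apply: measurable_rV_uncons => //; exact: measurableX.
by rewrite lebesgue_stepE// lte_mul_pinfty// ge0_fin_numE.
Qed.

HB.instance Definition _ := Measure_isSigmaFinite.Build _ _ _
  lebesgue_step lebesgue_step_sigma_finite.

End step.

Fixpoint lebesgue_measure_rV n : {sigma_finite_measure set 'rV[R]_n -> \bar R} :=
  match n with
  | 0 => \d_(0 : 'rV[R]_0)
  | n'.+1 => lebesgue_step (lebesgue_measure_rV n')
  end.

End lebesgue_measure_rV.

Section test_fields.
Context {R : realType} {n : nat}.
Local Notation mu := (@lebesgue_measure_rV R n).
Implicit Types (g : 'rV[R]_n -> R) (phi : 'rV[R]_n -> 'rV[R]_n).

(* The library's norm on 'rV[R]_n is the sup norm; enorm is the Euclidean one. *)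
Definition dot (x y : 'rV[R]_n) : R := \sum_(i < n) x ord0 i * y ord0 i.

Definition enorm (x : 'rV[R]_n) : R := Num.sqrt (dot x x).

Definition basis_rV (i : 'I_n) : 'rV[R]_n := delta_mx ord0 i.

Definition partial (i : 'I_n) g : 'rV[R]_n -> R := 'D_(basis_rV i) g.

Fixpoint Ck (k : nat) g : Prop :=
  if k is k'.+1 then
    [/\ continuous g,
        forall i x, derivable g x (basis_rV i) &
        forall i, Ck k' (partial i g)]
  else continuous g.

Definition Cinfty g := forall k, Ck k g.

Definition supp phi : set 'rV[R]_n := closure [set x | phi x != 0].

(* Fields in C^infty_c(Omega; R^n) are extended by 0 to all of R^n. *)
Definition Cinfty_c (Omega : set 'rV[R]_n) phi :=
  [/\ forall j, Cinfty (fun x => phi x ord0 j),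
      compact (supp phi) & supp phi `<=` Omega].

(* The restriction sets the function to 0 outside Omega, which does not       *)
(* affect the essential supremum over Omega of a nonnegative function.        *)
Definition Linfty_norm (Omega : set 'rV[R]_n) phi : \bar R :=
  'N[mu]_+oo[(fun x => (enorm (phi x))%:E) \_ Omega].

Definition test_fields (Omega : set 'rV[R]_n) : set ('rV[R]_n -> 'rV[R]_n) :=
  [set phi | Cinfty_c Omega phi /\ (Linfty_norm Omega phi <= 1)%E].

End test_fields.

(* Euler's integral, meaningful for 0 < s. *)
Definition Gamma {R : realType} (s : R) : R :=
  \int[lebesgue_measure]_(t in `]0, +oo[) (t `^ (s - 1) * expR (- t)).

Section variations.
Context {R : realType} {n : nat}.
Local Notation mu := (@lebesgue_measure_rV R n).
Implicit Types (g : 'rV[R]_n -> R) (phi : 'rV[R]_n -> 'rV[R]_n) (alpha : R).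

Definition frac_const alpha : R :=
  2 `^ alpha * pi `^ (- (n%:R / 2))
  * (Gamma ((n%:R + alpha + 1) / 2) / Gamma ((1 - alpha) / 2)).

Definition divergence phi (x : 'rV[R]_n) : R :=
  \sum_(i < n) partial i (fun y => phi y ord0 i) x.

(* At y = x the integrand is 0 / 0 = 0. *)
Definition frac_divergence alpha phi (x : 'rV[R]_n) : R :=
  frac_const alpha *
  \int[mu]_y (dot (y - x) (phi y - phi x) / enorm (y - x) `^ (n%:R + alpha + 1)).

Definition div_variation g (Omega : set 'rV[R]_n) : \bar R :=
  ereal_sup [set (\int[mu]_x (g x * divergence phi x)%:E)%E
            | phi in test_fields Omega].

Definition frac_variation alpha g (Omega : set 'rV[R]_n) : \bar R :=
  ereal_sup [set (\int[mu]_x (g x * frac_divergence alpha phi x)%:E)%E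
            | phi in test_fields Omega].

End variations.

Section Lebesgue_spaces.
Context {R : realType} {n : nat}.
Local Notation mu := (@lebesgue_measure_rV R n).
Local Open Scope ereal_scope.
Implicit Types (g f : 'rV[R]_n -> R) (F : R -> 'rV[R]_n -> R).

Definition L1 g := mu.-integrable setT (EFin \o g).

Definition L1loc g := measurable_fun setT g /\
  forall K : set 'rV[R]_n, compact K -> \int[mu]_(x in K) `|g x|%:E < +oo.

Definition cvg_L1 F f :=
  'N[mu]_1[(fun x => (F alpha x - f x)%:E)] @[alpha --> (1%R : R)^'-] --> 0.

Definition cvg_L1loc F f := forall K : set 'rV[R]_n, compact K ->
  \int[mu]_(x in K) `|F alpha x - f x|%:E @[alpha --> (1%R : R)^'-] --> 0.

End Lebesgue_spaces.

(* Main.v *)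
(* Euler's integral with t = e^r gives, for 2s = n + alpha + 1,
     |h|^(-2s) = Gamma(s)^-1 int_R exp(s r - e^r |h|^2) dr.
   By Fubini, div^alpha phi(x) = kappa int_R e^(s r) A_r(x) dr, where
     A_r(x) = int e^(- e^r |h|^2) h . (phi(x + h) - phi(x)) dh,
     kappa = 2^alpha pi^(-n/2) / Gamma(eps),  eps = (1 - alpha) / 2,
   and kappa -> 0 as alpha -> 1.  For r < 0 the average A_r is bounded directly.
   For r >= 0, Gaussian integration by parts gives
     A_r(x) = (e^(-r) / 2) int e^(- e^r |h|^2) (div phi)(x + h) dh,
   which is (pi^(n/2) / 2) e^(-(n + 2) r / 2) div phi(x) up to the Lipschitz error
   of div phi.  The main terms add up to the multiple 2^(alpha - 1) / (eps Gamma(eps))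
   of div phi(x), and this factor tends to 1; the errors are bounded in L^oo and in
   L^1 before the multiplication by kappa.  Thus div^alpha phi -> div phi in both
   norms at rate O(1 - alpha), and lower semicontinuity follows by testing against
   a fixed phi. *)

From HB Require Import structures.
Require Import Defs.
From mathcomp Require Import all_boot all_order all_algebra.
From mathcomp Require Import all_classical all_reals all_analysis.
From mathcomp Require Import measurable_realfun ess_sup_inf.
From mathcomp Require Import ring lra.

Set Implicit Arguments.
Unset Strict Implicit.
Unset Printing Implicit Defensive.

Import Order.TTheory GRing.Theory Num.Theory.
Import numFieldNormedType.Exports.

Local Open Scope classical_set_scope.
Local Open Scope ring_scope.

(** * Lebesgue measure on row vectors *)

(** The kernel is singular at the origin and has a heavy tail, and the fractional divergence of a
    compactly supported field need not have compact support. Gaussians meet the first difficulty: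
    they factor over the coordinates, so the recursively defined measure suffices and no integration
    over spheres occurs. Euler's integral also consumes the factor [Gamma((n+alpha+1)/2)] of the
    normalising constant; what is left to know about Gamma is its behaviour [eps Gamma(eps) -> 1] at
    0. The second difficulty is met by replacing the support with a Gaussian weight, [gauss_bump].
    It is bounded, integrable, and has the same integral after a translation, so one pointwise
    estimate yields the sup bound and the L^1 bound with the same constants. Both are needed: in (i)
    the family is bounded in L^oo and is paired with L^1 convergence of the divergences, in (ii) it
    converges in L^1 and is paired with their uniform convergence. *)

Section borel.
Context {R : realType} {n : nat}.
Local Notation V := 'rV[R]_n.

Lemma measurable_ball_rV (x : V) (r : R) : measurable (ball x r).
Proof.
(* A ball of row vectors carries the conjunct [0 < r]. The case [r <= 0] is separated because for
   [n = 0] the intersection over coordinates would be the whole space, not the empty ball. *)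
have [r0|r0] := leP r 0.
  rewrite (_ : ball x r = set0); first exact: measurable0.
  by apply/seteqP; split => // y [/=]; rewrite ltNge r0.
rewrite (_ : ball x r = \bigcap_(i in [set: 'I_n])
    (fun y : V => y ord0 i) @^-1` ball (x ord0 i) r).
  apply: fin_bigcap_measurable => // i _; rewrite -[X in measurable X]setTI.
  apply: measurable_coord => //; exact: measurable_ball.
apply/seteqP; split => y /=; first by move=> [_ xy] i _; exact: xy.
by move=> xy; split => // i j; rewrite ord1; exact: xy.
Qed.

(** An open set is the union of the countably many balls with rational centre and radius [1/(m+1)]
    that it contains. *)
Lemma open_measurable_rV (A : set V) : open A -> measurable A.
Proof.
move=> oA.
pose B (p : 'rV[rat]_n * nat) : set V :=
  ball (map_mx ratr p.1 : V) (p.2.+1%:R^-1).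
pose F p : set V := if pselect (B p `<=` A) then B p else set0.
rewrite (_ : A = \bigcup_p F p).
  apply: countable_bigcupT_measurable => [|p]; first exact: countableP.
  by rewrite /F; case: pselect => ?; [exact: measurable_ball_rV|exact: measurable0].
apply/seteqP; split => [x Ax|x [p _]]; last first.
  by rewrite /F; case: pselect => // BA; exact: BA.
have /nbhs_ballP[e /= e0 eA] : nbhs x A by exact: open_nbhs_nbhs.
(* Here [2r < e], so a ball of radius r whose centre is within r of x contains x and stays inside
   [ball x e]. *)
pose m := Num.truncn (2 / e); pose r : R := m.+1%:R^-1.
have r0 : 0 < r by rewrite invr_gt0.
have re : r + r < e.
  have : 2 / e < m.+1%:R by exact: truncnS_gt.
  rewrite ltr_pdivrMr// -ltr_pdivrMl ?ltr0n// -/r => h.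
  by rewrite -mulr2n -mulr_natl mulrC.
have /choice[c cP] : forall i, exists q : rat, ball (x ord0 i) r (ratr q).
  move=> i; have xr : x ord0 i - r < x ord0 i + r by rewrite ltrD2l gtrN.
  have [q] := rat_in_itvoo xr; rewrite in_itv/= => /andP[q1 q2].
  by exists q; rewrite /ball/= ltr_distlC q1.
pose c' := (\row_i c i) : 'rV[rat]_n.
exists (c', m) => //; rewrite /F; case: pselect => [BA|[]].
  by split => // i j; rewrite ord1 !mxE; exact/ball_sym/cP.
move=> y [_ cy]; apply: eA; split => // i j; rewrite ord1.
apply: le_ball (ltW re) _ _; apply: ball_triangle (cP j) _.
by have := cy ord0 j; rewrite !mxE.
Qed.

Lemma closed_measurable_rV (A : set V) : closed A -> measurable A.
Proof.
by move=> /closed_openC /open_measurable_rV /measurableC; rewrite setCK.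
Qed.

Lemma continuous_measurable_rV (f : V -> R) :
  continuous f -> measurable_fun setT f.
Proof.
move=> /continuousP cf; apply: (measurability _ (RGenOpens.measurableE R)).
move=> _ [U [a [b ->]] <-]; rewrite setTI; apply: open_measurable_rV.
by apply: cf; exact: interval_open.
Qed.

Lemma measurable_rVD d (T : measurableType d) (f g : T -> V) :
  measurable_fun setT f -> measurable_fun setT g ->
  measurable_fun setT (fun x => f x + g x).
Proof.
move=> mf mg; apply: measurable_fun_rV => i; under eq_fun do rewrite mxE.
by apply: measurable_funD; apply: measurableT_comp (measurable_coord i) _.
Qed.

End borel.

Lemma ge0_integral_rVS (R : realType) n (f : 'rV[R]_n.+1 -> \bar R) :
  measurable_fun setT f -> (forall x, 0 <= f x)%E ->
  (\int[lebesgue_measure_rV n.+1]_x f x =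
   \int[lebesgue_measure_rV n]_y \int[lebesgue_measure]_x f (rV_cons (x, y)))%E.
Proof.
move=> mf f0; rewrite /=.
transitivity (\int[lebesgue_measure \x lebesgue_measure_rV n]_p (f \o @rV_cons R n) p)%E.
  exact: (ge0_integral_pushforward (@measurable_rV_cons R n)).
rewrite fubini_tonelli2//; last by move=> p; exact: f0.
by apply: measurableT_comp mf _; exact: measurable_rV_cons.
Qed.

(** * Translation invariance and the Gaussian integral on R^n *)

Section translation.
Context {R : realType}.
Local Open Scope ereal_scope.

(** The image measure has the right value on half-open intervals, and these determine Lebesgue
    measure. *)
Lemma lebesgue_measure_shift (a : R) (A : set R) : measurable A ->
  pushforward lebesgue_measure ((fun x => x + a)%R : _ -> measurableTypeR R) A = lebesgue_measure A.
Proof.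
move=> mA.
have ma : measurable_fun setT ((fun x => x + a)%R : measurableTypeR R -> measurableTypeR R).
  exact: measurable_funD.
pose am := isMeasurableFun.Build _ _ _ _ _ ma.
pose phi : {mfun _ >-> _} := HB.pack (fun x : measurableTypeR R => x + a : measurableTypeR R)%R am.
apply/esym; apply: (lebesgue_measure_unique (mu := pushforward lebesgue_measure phi)) => //= _
  [[b c]] _ <-.
rewrite /pushforward (_ : _ @^-1` _ = `]b - a, c - a]%classic)%R.
  rewrite !lebesgue_measure_itv/= !lte_fin ltrD2r; congr (if _ then _ else _).
  by congr EFin; ring.
by apply/seteqP; split => x/=; rewrite !in_itv/= ltrBlDr lerBrDr.
Qed.

Lemma ge0_integral_shift (a : R) (f : measurableTypeR R -> \bar R) :
  measurable_fun setT f -> (forall x, 0 <= f x) ->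
  \int[lebesgue_measure]_x f (x + a)%R = \int[lebesgue_measure]_x f x.
Proof.
move=> mf f0.
have ma : measurable_fun setT ((fun x => x + a)%R : measurableTypeR R -> measurableTypeR R).
  exact: measurable_funD.
pose am := isMeasurableFun.Build _ _ _ _ _ ma.
pose phi : {mfun _ >-> _} := HB.pack (fun x : measurableTypeR R => x + a : measurableTypeR R)%R am.
transitivity (\int[pushforward lebesgue_measure phi]_x f x).
  by rewrite (ge0_integral_pushforward ma).
by apply: eq_measure_integral => A mA _; exact: lebesgue_measure_shift.
Qed.

Lemma measurable_rV_shift n (b : 'rV[R]_n) (g : 'rV[R]_n -> \bar R) :
  measurable_fun setT g ->
  measurable_fun [set: 'rV[R]_n] (fun x : 'rV[R]_n => g (x + b)%R).
Proof.
move=> mg.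
apply: (@measurableT_comp _ _ _ _ _ _ g setT (fun x : 'rV[R]_n => (x + b)%R)) => //.
exact: measurable_rVD.
Qed.

(** Induction on n: the first coordinate is shifted in the inner integral, the remaining ones by the
    induction hypothesis in the outer one. For [n = 0] the space is a point. *)
Lemma ge0_integral_rV_shift n (a : 'rV[R]_n) (f : 'rV[R]_n -> \bar R) :
  measurable_fun setT f -> (forall x, 0 <= f x) ->
  \int[lebesgue_measure_rV n]_x f (x + a)%R = \int[lebesgue_measure_rV n]_x f x.
Proof.
elim: n a f => [|n IH] a f mf f0.
  by apply: eq_integral => x _; congr f; apply/rowP; case.
rewrite [LHS]ge0_integral_rVS//; last exact: measurable_rV_shift.
rewrite [RHS](ge0_integral_rVS mf f0).
pose a2 : 'rV[R]_n := \row_j a ord0 (lift ord0 j).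
have mF : measurable_fun setT (fun p : measurableTypeR R * 'rV[R]_n => f (rV_cons p)).
  by apply: measurableT_comp mf _; exact: measurable_rV_cons.
rewrite -[RHS](IH a2).
- apply: eq_integral => y _.
  rewrite -[RHS](ge0_integral_shift (a ord0 ord0)).
  + apply: eq_integral => x _; congr f; apply/rowP => i.
    case: (unliftP ord0 i) => [j|] ->; rewrite mxE.
      by rewrite !rV_consES !mxE.
    by rewrite !rV_consE0.
  + by apply: measurableT_comp mF _; exact: pair2_measurable.
  + by move=> x; exact: f0.
- exact: (measurable_fun_fubini_tonelli_G (m1 := lebesgue_measure) _ mF).
- by move=> y; apply: integral_ge0 => x _.
Qed.

Lemma integral_rV_shift n (a : 'rV[R]_n) (f : 'rV[R]_n -> \bar R) :
  measurable_fun setT f ->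
  \int[lebesgue_measure_rV n]_x f (x + a)%R = \int[lebesgue_measure_rV n]_x f x.
Proof.
move=> mf; rewrite [LHS]integralE [RHS]integralE; congr (_ - _).
  rewrite -[RHS](ge0_integral_rV_shift a (measurable_funepos mf) (fun x => funepos_ge0 f x)).
  by apply: eq_integral => x _; rewrite !funeposE.
rewrite -[RHS](ge0_integral_rV_shift a (measurable_funeneg mf) (fun x => funeneg_ge0 f x)).
by apply: eq_integral => x _; rewrite !funenegE.
Qed.

(** Up to its peak value the integrand is the normal density of mean 0 and variance [1/(2t)], which
    has integral 1. *)
Lemma integral_gauss_scale (t : R) : (0 < t)%R ->
  \int[lebesgue_measure]_x (expR (- (t * x ^+ 2)))%:E = (Num.sqrt (pi / t))%:E.
Proof.
move=> t0; pose s := Num.sqrt (2 * t)^-1.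
have t20 : (0 < (2 * t)^-1)%R by rewrite invr_gt0 mulr_gt0.
have s2 : (s ^+ 2 = (2 * t)^-1)%R by rewrite sqr_sqrtr// ltW.
have s0 : s != 0%R by rewrite gt_eqF// sqrtr_gt0.
have := integral_normal_pdf 0%R s; rewrite /normal_pdf (negbTE s0).
rewrite /normal_peak /normal_fun s2 => h.
have peak : (Num.sqrt ((2 * t)^-1 * pi *+ 2) = Num.sqrt (pi / t))%R.
  by congr Num.sqrt; rewrite -mulr_natr; field; rewrite gt_eqF.
have sp0 : (0 < Num.sqrt (pi / t))%R by rewrite sqrtr_gt0 divr_gt0// pi_gt0.
rewrite peak in h.
transitivity (\int[lebesgue_measure]_x ((Num.sqrt (pi / t))%:E *
  (((Num.sqrt (pi / t))^-1 * expR (- (x - 0) ^+ 2 / ((2 * t)^-1 *+ 2)))%R)%:E)).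
  apply: eq_integral => x _; rewrite -EFinM mulVKf ?gt_eqF//.
  by congr (expR _)%:E; rewrite subr0 -mulr_natr; field; rewrite gt_eqF.
rewrite ge0_integralZl//.
- by rewrite h mule1.
- apply/measurable_EFinP; apply: measurable_funM => //; apply: measurableT_comp => //.
  apply: measurable_funM => //; apply: measurableT_comp => //; apply: measurable_funX => //.
  exact: measurable_funB.
Qed.

Lemma measurable_dot n d (T : measurableType d) (f g : T -> 'rV[R]_n) :
  measurable_fun setT f -> measurable_fun setT g ->
  measurable_fun setT (fun x => dot (f x) (g x)).
Proof.
move=> mf mg; apply: measurable_sum => i; apply: measurable_funM.
  by apply: measurableT_comp (measurable_coord i) _.
by apply: measurableT_comp (measurable_coord i) _.
Qed.

(** Each recursion step of the measure splits off a one-dimensional Gaussian factor; the Dirac mass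
    at [n = 0] gives the empty product. *)
Lemma integral_gauss_rV n (t : R) : (0 < t)%R ->
  \int[lebesgue_measure_rV n]_h (expR (- (t * dot h h)))%:E = (Num.sqrt (pi / t) ^+ n)%:E.
Proof.
move=> t0; elim: n => [|n IH].
  rewrite [LHS]integral_dirac//=; last first.
    apply/measurable_EFinP; apply: measurableT_comp => //; apply: measurableT_comp => //.
    by apply: measurable_funM => //; exact: measurable_dot.
  by rewrite diracT mul1e /dot big_ord0 mulr0 oppr0 expR0 expr0.
rewrite ge0_integral_rVS/=; last 2 first.
- apply/measurable_EFinP; apply: measurableT_comp => //; apply: measurableT_comp => //.
  by apply: measurable_funM => //; exact: measurable_dot.
- by move=> x; rewrite lee_fin expR_ge0.
transitivity (\int[lebesgue_measure_rV n]_y ((Num.sqrt (pi / t))%:E * (expR (- (t * dot y y)))%:E)).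
  apply: eq_integral => y _.
  transitivity (\int[lebesgue_measure]_x ((expR (- (t * dot y y)))%:E *
    (expR (- (t * x ^+ 2)))%:E)).
    apply: eq_integral => x _; rewrite -EFinM -expRD; congr (expR _)%:E.
    rewrite /dot big_ord_recl rV_consE0/= (eq_bigr (fun i => y ord0 i * y ord0 i)%R).
      by rewrite expr2; ring.
    by move=> i _; rewrite rV_consES.
  rewrite ge0_integralZl//.
  - by rewrite integral_gauss_scale// muleC.
  - apply/measurable_EFinP; apply: measurableT_comp => //; apply: measurableT_comp => //.
    by apply: measurable_funM => //; exact: measurable_funX.
rewrite ge0_integralZl//.
- by rewrite IH -EFinM exprS.
- apply/measurable_EFinP; apply: measurableT_comp => //; apply: measurableT_comp => //.
  by apply: measurable_funM => //; exact: measurable_dot.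
Qed.

End translation.

(** * Euler's Gamma integral in exponential form *)

Section one_dimensional.
Context {R : realType}.
Local Notation leb := (@lebesgue_measure R).
Local Open Scope ereal_scope.
Implicit Types (a b s r c : R).

Lemma integral_expRN a : (0 < a)%R ->
  \int[leb]_(r in `[0%R, +oo[) (expR (- (a * r)))%:E = (a^-1)%:E.
Proof.
move=> a0.
have dF r : is_derive r 1%R (fun r => - (a^-1 * expR (- (a * r))))%R (expR (- (a * r))).
  have d1 : is_derive r 1%R (fun r => - (a * r))%R (- a)%R.
    have -> : (fun r => - (a * r))%R = (fun r => (- a) *: r)%R.
      by apply/funext => z; rewrite /GRing.scale/= mulNr.
    by apply: is_derive_eq; rewrite /GRing.scale/= mulr1.
  have d2 := @is_derive1_comp R expR (fun r => - (a * r))%R r _ _ (is_derive_expR _) d1.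
  have -> : (fun r => - (a^-1 * expR (- (a * r))))%R =
            (fun r => (- a^-1) *: (expR \o (fun r => - (a * r))) r)%R.
    by apply/funext => z; rewrite /GRing.scale/= mulNr.
  by apply: is_derive_eq; rewrite /GRing.scale/=; field; rewrite gt_eqF.
have cF : continuous (fun r => - (a^-1 * expR (- (a * r))))%R.
  by move=> r; apply/differentiable_continuous/derivable1_diffP; case: (dF r).
rewrite (@ge0_continuous_FTC2y R _ (fun r => - (a^-1 * expR (- (a * r))))%R 0%R 0%R).
- by rewrite mulr0 oppr0 expR0 mulr1 sub0e -EFinN opprK.
- by move=> r _; exact: expR_ge0.
- apply: continuous_subspaceT => r; apply: continuous_comp; last exact: continuous_expR.
  by apply: cvgN; apply: cvgM; [exact: cvg_cst|exact: cvg_id].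
- rewrite -[X in _ --> X]oppr0 -[X in _ --> (- X)%R](mulr0 (a^-1)%R); apply: cvgN; apply: cvgM;
  first exact: cvg_cst.
  apply: (cvg_comp _ _ _ (@cvgr_expR R)); apply: gt0_cvgMry => //; exact: cvg_id.
- by move=> r _; case: (dF r).
- by apply: cvg_at_right_filter; exact: cF.
- by move=> r _; rewrite derive1E; apply: derive_val.
Qed.

(** Majorant for integrals over the logarithmic variable r: for positive a and b it decays at rate a
    towards -oo and at rate b towards +oo, with an explicit integral. *)
Definition two_sided_expR a b r :=
  if (r < 0)%R then expR (a * r) else expR (- (b * r)).

Lemma measurable_two_sided_expR a b : measurable_fun setT (two_sided_expR a b).
Proof.
apply: measurable_fun_ifT.
- exact: measurable_fun_ltr.
- by apply: measurableT_comp => //; exact: measurable_funM.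
- by apply: measurableT_comp => //; apply: measurableT_comp => //; exact: measurable_funM.
Qed.

Lemma two_sided_expR_ge0 a b r : (0 <= two_sided_expR a b r)%R.
Proof. by rewrite /two_sided_expR; case: ifP => _; exact: expR_ge0. Qed.

Lemma integral_expR_neg a : (0 < a)%R ->
  \int[leb]_(r in `]-oo, 0%R[) (expR (a * r))%:E = (a^-1)%:E.
Proof.
move=> a0; rewrite integral_itv_bndo_bndc; last first.
  apply/measurable_EFinP; apply: measurable_funTS.
  by apply: measurableT_comp => //; exact: measurable_funM.
rewrite -(integral_expRN a0) (ge0_integration_by_substitution0
  (f := fun r => (expR (- (a * r)))%:E)).
- by apply: eq_integral => r _; rewrite mulrN opprK.
- apply/measurable_EFinP; do 2 (apply: measurableT_comp => //).
- by move=> r; rewrite lee_fin expR_ge0.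
Qed.

Lemma integral_two_sided_expR a b : (0 < a)%R -> (0 < b)%R ->
  \int[leb]_r (two_sided_expR a b r)%:E = (a^-1 + b^-1)%:E.
Proof.
move=> a0 b0.
have -> : [set: R] = `]-oo, 0%R[ `|` `[0%R, +oo[.
  by apply/seteqP; split => // r _; rewrite /= !in_itv/= andbT; case: (ltP r 0%R); [left|right].
rewrite ge0_integral_setU//=.
- rewrite EFinD -(integral_expR_neg a0) -(integral_expRN b0); congr (_ + _).
    by apply: eq_integral => r; rewrite inE/= in_itv/= /two_sided_expR => ->.
  by apply: eq_integral => r; rewrite inE/= in_itv/= andbT /two_sided_expR leNgt => /negbTE ->.
- apply/measurable_EFinP; apply: measurable_funTS; exact: measurable_two_sided_expR.
- by move=> r _; rewrite lee_fin two_sided_expR_ge0.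
- apply/disj_setPS => r/= []; rewrite !in_itv/= andbT => r1; rewrite leNgt r1//.
Qed.

Lemma measurable_gamma_kernel s c :
  measurable_fun [set: R] (fun r : R => expR (s * r - expR r * c)%R).
Proof.
apply: measurableT_comp => //; apply: measurable_funB; first exact: measurable_funM.
by apply: measurable_funM => //; exact: measurable_expR.
Qed.

(** The substitution [t = e^r] is made on the compact intervals [[e^(-k), e^k]], the images of
    [[-k, k]]. Both families exhaust their domains and the integrands are nonnegative, so monotone
    convergence gives the full integrals. *)
Lemma Gamma_substitution s :
  \int[leb]_(t in `]0%R, +oo[) (t `^ (s - 1) * expR (- t))%:E =
  \int[leb]_r (expR (s * r - expR r))%:E.
Proof.
pose G t := (expR ((s - 1) * ln t) * expR (- t))%R.
have cG t : (0 < t)%R -> {for t, continuous G}.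
  move=> t0.
  have c1 : (expR ((s - 1) * ln x))%R @[x --> t] --> expR ((s - 1) * ln t)%R.
    apply: (@cvg_comp _ _ _ (fun x => (s - 1) * ln x)%R expR _ (nbhs ((s - 1) * ln t)%R));
      last exact: continuous_expR.
    by apply: cvgM; [exact: cvg_cst|exact: continuous_ln].
  have c2 : expR (- x)%R @[x --> t] --> expR (- t)%R.
    apply: (@cvg_comp _ _ _ (fun x => - x)%R expR _ (nbhs (- t)%R)); last exact: continuous_expR.
    by apply: cvgN; exact: cvg_id.
  exact: cvgM c1 c2.
have mG : measurable_fun setT G.
  apply: measurable_funM; apply: measurableT_comp => //.
  by apply: measurable_funM => //; exact: measurable_ln.
pose A (k : nat) := `[expR (- k%:R), expR k%:R]%classic : set R.
pose B (k : nat) := `[(- k%:R)%R, k%:R]%classic : set R.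
have AU : \bigcup_k A k = `]0%R, +oo[%classic.
  apply/seteqP; split => t.
    by case=> k _; rewrite /A/= !in_itv/= andbT => /andP[+ _]; apply: lt_le_trans; exact: expR_gt0.
  rewrite /= in_itv/= andbT => t0; exists (Num.truncn `|ln t|).+1 => //.
  have h : (`|ln t| <= (Num.truncn `|ln t|).+1%:R)%R by exact/ltW/truncnS_gt.
  by rewrite /A/= in_itv/= -{2 3}(lnK t0) !ler_expR -ler_norml.
have BU : \bigcup_k B k = setT.
  apply/seteqP; split => // r _; exists (Num.truncn `|r|).+1 => //.
  have h : (`|r| <= (Num.truncn `|r|).+1%:R)%R by exact/ltW/truncnS_gt.
  by rewrite /B/= in_itv/= -ler_norml.
transitivity (\int[leb]_(t in `]0%R, +oo[) (G t)%:E).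
  apply: eq_integral => t; rewrite inE/= in_itv/= andbT => t0.
  by rewrite /G /powR gt_eqF.
rewrite -AU -BU.
have lA := @ge0_nondecreasing_set_cvg_integral _ (measurableTypeR R) R A (EFin \o G) leb.
have lB := @ge0_nondecreasing_set_cvg_integral _ (measurableTypeR R) R B
  (fun r => (expR (s * r - expR r))%:E) leb.
apply: (cvg_unique _ (lA _ _ _ _) _) => //.
- move=> k m km; apply/subsetPset => t; rewrite /A/= !in_itv/= => /andP[t1 t2].
  by rewrite (le_trans _ t1) ?(le_trans t2)// ler_expR ?lerN2 ler_nat.
- by move=> k; exact: measurable_itv.
- by move=> k; apply: measurable_funTS; exact/measurable_EFinP.
- by move=> k t _; rewrite lee_fin mulr_ge0 ?expR_ge0.
rewrite (_ : (fun i => _) = fun i => \int[leb]_(x in B i) (expR (s * x - expR x))%:E).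
  apply: lB.
  + move=> k m km; apply/subsetPset => t; rewrite /B/= !in_itv/= => /andP[t1 t2].
    by rewrite (le_trans _ t1) ?(le_trans t2)// ?lerN2 ler_nat.
  + by move=> k; exact: measurable_itv.
  + move=> k; apply: measurable_funTS; apply/measurable_EFinP.
    by have := measurable_gamma_kernel s 1; under eq_fun do rewrite mulr1.
  + by move=> k t _; rewrite lee_fin expR_ge0.
have dE : (expR : R -> R)^`()%classic = expR by apply/funext => z; rewrite derive1E;
  apply: derive_val.
apply/funext => k; rewrite /A /B.
rewrite (@integration_by_substitution_increasing R expR G); rewrite ?dE.
(* The Jacobian [e^r] raises the exponent from [s - 1] to s. *)
- apply: eq_integral => r _; rewrite !fctE /G expRK -!expRD; congr (expR _)%:E; ring.
- by rewrite lerNl (@le_trans _ _ 0%R)// oppr_le0.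
- by move=> x y _ _; rewrite ltr_expR.
- by move=> x _; exact: continuous_expR.
- by apply/cvg_ex; eexists; apply: cvg_at_right_filter; exact: continuous_expR.
- by apply/cvg_ex; eexists; apply: cvg_at_left_filter; exact: continuous_expR.
- split; first by move=> x _; exact: derivable_expR.
  + by apply: cvg_at_right_filter; exact: continuous_expR.
  + by apply: cvg_at_left_filter; exact: continuous_expR.
- apply: continuous_in_subspaceT => t; rewrite inE/= in_itv/= => /andP[t1 _].
  by apply: cG; apply: lt_le_trans t1; exact: expR_gt0.
Qed.

(** For [r < 0] the factor [exp(-e^r)] is at most 1. For [r >= 0], [e^r >= (1 + r/2)^2], and
    completing the square in [(s+1) r - r^2/4 <= (s+1)^2] produces the constant. *)
Lemma gamma_kernel_le s r :
  (expR (s * r - expR r) <= (expR ((s + 1) ^+ 2)) * two_sided_expR s 1 r)%R.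
Proof.
rewrite /two_sided_expR; case: ltP => r0; rewrite -expRD ler_expR.
  by have := expR_gt0 r; have := sqr_ge0 (s + 1); lra.
have h : (1 + r / 2 <= expR (r / 2))%R by exact: expR_ge1Dx.
have -> : expR r = (expR (r / 2) ^+ 2)%R.
  by rewrite expr2 -expRD; congr expR; field.
have : ((1 + r / 2) ^+ 2 <= expR (r / 2) ^+ 2)%R.
  by rewrite ler_sqr// nnegrE ?expR_ge0// addr_ge0// divr_ge0.
move: (expR (r / 2) ^+ 2)%R => E.
by have := sqr_ge0 (s + 1 - r / 2); rewrite !expr2; lra.
Qed.

(** [Gamma] is the real part of an extended integral and agrees with it only once that integral is
    known to be finite; the two-sided majorant shows this. *)
Lemma Gamma_integral s : (0 < s)%R ->
  \int[leb]_r (expR (s * r - expR r))%:E = (Gamma s)%:E.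
Proof.
move=> s0; rewrite /Gamma /Rintegral Gamma_substitution fineK//.
rewrite ge0_fin_numE; last by apply: integral_ge0 => r _; rewrite lee_fin expR_ge0.
apply: (@le_lt_trans _ _ (\int[leb]_r ((expR ((s + 1) ^+ 2))%:E * (two_sided_expR s 1 r)%:E))).
  apply: ge0_le_integral => //.
  - by have := measurable_gamma_kernel s 1; under eq_fun do rewrite mulr1; move/measurable_EFinP.
  - apply/measurable_EFinP; apply: measurable_funM => //; exact: measurable_two_sided_expR.
  - by move=> r _; rewrite -EFinM lee_fin gamma_kernel_le.
rewrite ge0_integralZl ?lee_fin ?expR_ge0//.
- by rewrite integral_two_sided_expR// -EFinM ltry.
- by apply/measurable_EFinP; exact: measurable_two_sided_expR.
- by move=> r _; rewrite lee_fin two_sided_expR_ge0.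
Qed.

(** The half-line [r < 0] carries the pole: there the kernel is below [e^(s r)], whose integral is
    [1/s]. The other half contributes a term bounded for small s. Together with [Gamma_ge] this
    gives [s Gamma(s) -> 1] at 0. *)
Lemma Gamma_le s : (0 < s)%R -> (Gamma s <= s^-1 + expR ((s + 1) ^+ 2))%R.
Proof.
move=> s0; rewrite -lee_fin -Gamma_integral//.
have -> : [set: R] = `]-oo, 0%R[ `|` `[0%R, +oo[.
  by apply/seteqP; split => // r _; rewrite /= !in_itv/= andbT; case: (ltP r 0%R); [left|right].
have mk : measurable_fun setT (fun r : R => (expR (s * r - expR r))%:E).
  by have := measurable_gamma_kernel s 1; under eq_fun do rewrite mulr1; move/measurable_EFinP.
rewrite ge0_integral_setU//=.
- rewrite EFinD; apply: leeD.
    rewrite -integral_expR_neg//; apply: ge0_le_integral => //.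
    + exact: measurable_funTS.
    + apply/measurable_EFinP; apply: measurable_funTS.
      by apply: measurableT_comp => //; exact: measurable_funM.
    + by move=> r _; rewrite lee_fin ler_expR lerBlDr lerDl expR_ge0.
  have -> : (expR ((s + 1) ^+ 2))%:E = (expR ((s + 1) ^+ 2))%:E * (1^-1)%:E :> \bar R
    by rewrite invr1 mule1.
  rewrite -integral_expRN// -ge0_integralZl//.
  + apply: ge0_le_integral => //.
    * exact: measurable_funTS.
    * apply: measurable_funTS; apply/measurable_EFinP; apply: measurable_funM => //.
      by do 2 (apply: measurableT_comp => //); exact: measurable_funM.
    * move=> r; rewrite /= in_itv/= andbT => r0; rewrite -EFinM lee_fin.
      by have := gamma_kernel_le s r; rewrite /two_sided_expR ltNge r0.
  + apply: measurable_funTS; apply/measurable_EFinP.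
    by do 2 (apply: measurableT_comp => //); exact: measurable_funM.
- exact: measurable_funTS.
- apply/disj_setPS => r/= []; rewrite !in_itv/= andbT => r1; rewrite leNgt r1//.
Qed.

(** From [exp(-e^r) >= 1 - e^r], multiplied by [e^(s r)] and integrated over [r < 0]. *)
Lemma Gamma_ge s : (0 < s)%R -> (s^-1 <= Gamma s + (s + 1)^-1)%R.
Proof.
move=> s0; have s10 : (0 < s + 1)%R by rewrite addr_gt0.
rewrite -lee_fin EFinD -Gamma_integral// -!integral_expR_neg//.
have mk : measurable_fun setT (fun r : R => (expR (s * r - expR r))%:E).
  by have := measurable_gamma_kernel s 1; under eq_fun do rewrite mulr1; move/measurable_EFinP.
have me a : measurable_fun (`]-oo, 0%R[ : set R) (fun r : R => (expR (a * r))%:E).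
  by apply: measurable_funTS; apply/measurable_EFinP; apply: measurableT_comp => //.
apply: (@le_trans _ _ (\int[leb]_(r in `]-oo, 0%R[)
  ((expR (s * r - expR r))%:E + (expR ((s + 1) * r))%:E))).
  apply: ge0_le_integral => //.
  - exact: me.
  - by apply: emeasurable_funD; [exact: measurable_funTS|exact: me].
  - move=> r _; rewrite -EFinD lee_fin.
    have -> : expR ((s + 1) * r) = (expR (s * r) * expR r)%R by rewrite -expRD; congr expR; ring.
    rewrite expRD -mulrDr ler_peMr ?expR_ge0//.
    by have := expR_ge1Dx (- expR r); lra.
rewrite ge0_integralD//=; [|exact: measurable_funTS|exact: me].
apply: leeD => //; apply: ge0_subset_integral => //.
Qed.

Lemma Gamma_gt0 s : (0 < s)%R -> (0 < Gamma s)%R.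
Proof.
move=> s0; have := Gamma_ge s0; rewrite -lerBlDr; apply: lt_le_trans.
by rewrite subr_gt0 ltf_pV2 ?posrE ?addr_gt0// ltrDl.
Qed.

(** Scaling t by c is translating r by [ln c], and the factor [e^(s r)] then releases [c^(-s)]. *)
Lemma integral_gamma_kernel s c : (0 < s)%R -> (0 < c)%R ->
  \int[leb]_r (expR (s * r - expR r * c))%:E = (Gamma s / c `^ s)%:E.
Proof.
move=> s0 c0.
transitivity (\int[leb]_r ((expR (- (s * ln c)))%:E *
  (expR (s * (r + ln c) - expR (r + ln c)))%:E)).
  apply: eq_integral => r _; rewrite -EFinM -expRD; congr (expR _)%:E.
  rewrite [expR (r + _)]expRD lnK ?posrE//; ring.
have mk : measurable_fun setT (fun r : R => (expR (s * r - expR r))%:E).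
  by have := measurable_gamma_kernel s 1; under eq_fun do rewrite mulr1; move/measurable_EFinP.
rewrite ge0_integralZl//.
- rewrite (ge0_integral_shift (ln c) (f := fun r => (expR (s * r - expR r))%:E))//.
  by rewrite Gamma_integral// -EFinM mulrC /powR gt_eqF// expRN.
- apply: (measurableT_comp (f := (fun r : R => (expR (s * r - expR r))%:E))) => //.
  exact: measurable_funD.
Qed.

End one_dimensional.

(** * Gaussian integrals *)

Section euclidean.
Context {R : realType} {n : nat}.
Local Notation V := 'rV[R]_n.
Local Notation mu := (@lebesgue_measure_rV R n).
Implicit Types (h x y : V) (r t : R).

Lemma dot_ge0 h : 0 <= dot h h.
Proof. by apply: sumr_ge0 => i _; rewrite -expr2 sqr_ge0. Qed.

Lemma enorm_ge0 h : 0 <= enorm h. Proof. exact: sqrtr_ge0. Qed.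

Lemma sqr_enorm h : enorm h ^+ 2 = dot h h.
Proof. by rewrite sqr_sqrtr// dot_ge0. Qed.

Lemma coord_le_enorm h (i : 'I_n) : `|h ord0 i| <= enorm h.
Proof.
rewrite -(@ler_sqr _ `|_|) ?nnegrE ?normr_ge0 ?enorm_ge0// sqr_enorm /dot (bigD1 i)//=.
by rewrite -expr2 real_normK ?num_real// lerDl sumr_ge0// => j _; rewrite -expr2 sqr_ge0.
Qed.

Lemma enorm_eq0 h : (enorm h == 0) = (h == 0).
Proof.
apply/eqP/eqP => [h0|->]; last first.
  by rewrite /enorm /dot big1 ?sqrtr0// => i _; rewrite mxE mul0r.
apply/rowP => i; rewrite mxE; apply/normr0_eq0/eqP; rewrite eq_le normr_ge0 andbT.
by rewrite -h0 coord_le_enorm.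
Qed.

Lemma norm_dot_le h y (c : R) : (forall i, `|y ord0 i| <= c) ->
  `|dot h y| <= n%:R * c * enorm h.
Proof.
move=> yc; apply: (le_trans (ler_norm_sum _ _ _)).
apply: (@le_trans _ _ (\sum_(i < n) (enorm h * c))).
  by apply: ler_sum => i _; rewrite normrM ler_pM// coord_le_enorm.
by rewrite sumr_const card_ord -[leLHS]mulr_natl [enorm h * c]mulrC mulrA.
Qed.

Lemma dot_shift_basis h t (i : 'I_n) :
  dot (h + t *: basis_rV i) (h + t *: basis_rV i) =
  dot h h + (2 * t * h ord0 i + t ^+ 2).
Proof.
rewrite /dot [LHS](bigD1 i)//= [in RHS](bigD1 i)//= !mxE !eqxx/=.
rewrite (eq_bigr (fun j => h ord0 j * h ord0 j)); last first.
  by move=> j ji; rewrite !mxE (negbTE ji) andbF !mulr0 !addr0.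
by rewrite expr2; ring.
Qed.

Definition gauss_rV (t : R) h : R := expR (- (t * dot h h)).

Lemma gauss_rV_ge0 t h : 0 <= gauss_rV t h. Proof. exact: expR_ge0. Qed.

Lemma gauss_rV_le1 t h : 0 <= t -> gauss_rV t h <= 1.
Proof. by move=> t0; rewrite -expR0 ler_expR oppr_le0 mulr_ge0// dot_ge0. Qed.

Lemma measurable_gauss_rV t : measurable_fun setT (gauss_rV t).
Proof.
do 2 (apply: measurableT_comp => //); apply: measurable_funM => //.
exact: measurable_dot.
Qed.

Lemma measurable_enorm d (T : measurableType d) (f : T -> V) :
  measurable_fun setT f -> measurable_fun setT (fun z => enorm (f z)).
Proof.
move=> mf; apply: (@measurableT_comp _ _ _ _ _ _ (@Num.sqrt R) setT (fun z => dot (f z) (f z)));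
  last exact: measurable_dot.
by apply: continuous_measurable_fun; exact: sqrt_continuous.
Qed.

(** With [v = e^(r/2) |h|] this is [v e^(-v^2) <= e^(-v^2/2)]: half of the exponent absorbs the
    factor. The gain [e^(-r/2)] is the length scale of the Gaussian. *)
Lemma enorm_gauss_le r h :
  enorm h * gauss_rV (expR r) h <= expR (- (r / 2)) * gauss_rV (expR r / 2) h.
Proof.
set v := expR (r / 2) * enorm h.
have v0 : 0 <= v by rewrite mulr_ge0 ?expR_ge0 ?enorm_ge0.
have v2 : expR r * dot h h = v ^+ 2.
  by rewrite exprMn sqr_enorm expr2 -expRD; congr (expR _ * _); field.
rewrite /gauss_rV mulrAC v2.
have -> : enorm h = expR (- (r / 2)) * v.
  by rewrite /v mulrA -expRD addNr expR0 mul1r.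
rewrite -mulrA ler_wpM2l ?expR_ge0//.
move: v v0 {v2} => v v0; set w := v ^+ 2 / 2.
have -> : - v ^+ 2 = - w - w by rewrite /w; field.
have h1 : v <= expR w.
  by apply: le_trans (expR_ge1Dx _); rewrite /w; have := sqr_ge0 (v - 1); rewrite !expr2; lra.
rewrite expRD mulrA ler_piMl ?expR_ge0//.
by apply: (le_trans (ler_wpM2r (expR_ge0 _) h1)); rewrite -expRD subrr expR0.
Qed.

(** The same absorption with [v = e^r |h|^2] and [v <= 2 e^(v/2)]. *)
Lemma dot_gauss_le r h :
  dot h h * gauss_rV (expR r) h <= 2 * expR (- r) * gauss_rV (expR r / 2) h.
Proof.
rewrite /gauss_rV (_ : expR r / 2 * dot h h = expR r * dot h h / 2); last by field.
set v := expR r * dot h h.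
have v0 : 0 <= v by rewrite mulr_ge0 ?expR_ge0 ?dot_ge0.
have -> : dot h h = expR (- r) * v by rewrite /v mulrA -expRD addNr expR0 mul1r.
move: v v0 => v v0; rewrite [2 * _]mulrC -!mulrA ler_wpM2l ?expR_ge0//.
have -> : - v = - (v / 2) - v / 2 by field.
have h1 : v <= 2 * expR (v / 2) by have := expR_ge1Dx (v / 2); lra.
rewrite expRD mulrA ler_wpM2r ?expR_ge0//.
by apply: (le_trans (ler_wpM2r (expR_ge0 _) h1)); rewrite -mulrA -expRD subrr expR0 mulr1.
Qed.

Lemma integral_gauss_expR r :
  (\int[mu]_h (gauss_rV (expR r) h)%:E = (Num.sqrt pi ^+ n * expR (- (n%:R * r / 2)))%:E)%E.
Proof.
rewrite /gauss_rV integral_gauss_rV ?expR_gt0// sqrtrM ?pi_ge0// exprMn.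
congr (_ * _)%:E; have -> : Num.sqrt (expR r)^-1 = expR (- (r / 2)).
  have -> : (expR r)^-1 = expR (- (r / 2)) ^+ 2 by rewrite -expRN expr2 -expRD; congr expR; field.
  by rewrite sqrtr_sqr ger0_norm// expR_ge0.
by rewrite -expRM_natl; congr expR; field.
Qed.

Lemma integral_gauss_expR_half r :
  (\int[mu]_h (gauss_rV (expR r / 2) h)%:E = (Num.sqrt (2 * pi) ^+ n *
    expR (- (n%:R * r / 2)))%:E)%E.
Proof.
rewrite /gauss_rV integral_gauss_rV ?divr_gt0 ?expR_gt0//.
have -> : pi / (expR r / 2) = 2 * pi * expR (- (r / 2)) ^+ 2.
  have -> : expR (- (r / 2)) ^+ 2 = (expR r)^-1 by rewrite -expRN expr2 -expRD; congr expR; field.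
  by field; rewrite gt_eqF ?expR_gt0.
rewrite sqrtrM ?mulr_ge0 ?pi_ge0// sqrtr_sqr ger0_norm ?expR_ge0// exprMn.
by congr (_ * _)%:E; rewrite -expRM_natl; congr expR; field.
Qed.

(** The factor [|h|] gains [e^(-r/2)] over the total mass, of order [e^(-n r/2)]; [2 pi] replaces
    [pi] because the rate has been halved. *)
Lemma integral_enorm_gauss r :
  (\int[mu]_h (enorm h * gauss_rV (expR r) h)%:E <=
   (Num.sqrt (2 * pi) ^+ n * expR (- ((n%:R + 1) * r / 2)))%:E)%E.
Proof.
apply: (@le_trans _ _ (\int[mu]_h ((expR (- (r / 2)))%:E * (gauss_rV (expR r / 2) h)%:E))%E).
  apply: ge0_le_integral => //.
  - by move=> h _; rewrite lee_fin mulr_ge0 ?enorm_ge0 ?gauss_rV_ge0.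
  - apply/measurable_EFinP; apply: measurable_funM; last exact: measurable_gauss_rV.
    exact: measurable_enorm.
  - apply/measurable_EFinP; apply: measurable_funM => //; exact: measurable_gauss_rV.
  - by move=> h _; rewrite -EFinM lee_fin enorm_gauss_le.
rewrite ge0_integralZl//.
- rewrite integral_gauss_expR_half -EFinM mulrCA -expRD lee_fin.
  by rewrite le_eqVlt; apply/orP; left; apply/eqP; congr (_ * expR _); field.
- by apply/measurable_EFinP; exact: measurable_gauss_rV.
- by move=> h _; rewrite lee_fin gauss_rV_ge0.
Qed.

Lemma integral_dot_gauss r :
  (\int[mu]_h (dot h h * gauss_rV (expR r) h)%:E <=
   (2 * Num.sqrt (2 * pi) ^+ n * expR (- ((n%:R + 2) * r / 2)))%:E)%E.
Proof.
apply: (@le_trans _ _ (\int[mu]_h ((2 * expR (- r))%:E * (gauss_rV (expR r / 2) h)%:E))%E).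
  apply: ge0_le_integral => //.
  - by move=> h _; rewrite lee_fin mulr_ge0 ?dot_ge0 ?gauss_rV_ge0.
  - apply/measurable_EFinP; apply: measurable_funM; last exact: measurable_gauss_rV.
    exact: measurable_dot.
  - apply/measurable_EFinP; apply: measurable_funM => //; exact: measurable_gauss_rV.
  - by move=> h _; rewrite -EFinM lee_fin dot_gauss_le.
rewrite ge0_integralZl//.
- rewrite integral_gauss_expR_half -EFinM mulrACA -expRD lee_fin.
  by rewrite le_eqVlt; apply/orP; left; apply/eqP; congr (_ * expR _); field.
- by apply/measurable_EFinP; exact: measurable_gauss_rV.
- by move=> h _; rewrite lee_fin gauss_rV_ge0.
Qed.

Lemma integrable_gauss_rV t : 0 < t -> mu.-integrable setT (EFin \o gauss_rV t).
Proof.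
move=> t0; apply/integrableP; split.
  by apply/measurable_EFinP; exact: measurable_gauss_rV.
under eq_integral => h _ do rewrite /= ger0_norm ?gauss_rV_ge0//.
by rewrite integral_gauss_rV// ltry.
Qed.

Lemma integrable_le_gauss (f : V -> R) (c t : R) : 0 < t ->
  measurable_fun setT f -> (forall h, `|f h| <= c * gauss_rV t h) ->
  mu.-integrable setT (EFin \o f).
Proof.
move=> t0 mf fc.
apply: (@le_integrable _ _ _ mu setT _ _ (fun h => c%:E * (gauss_rV t h)%:E)%E) => //.
- by apply/measurable_EFinP.
- move=> h _; rewrite /= lee_fin; apply: (le_trans (fc h)); exact: ler_norm.
- by apply: integrableZl => //; exact: integrable_gauss_rV.
Qed.

End euclidean.

(** * Gaussian integration by parts *)

Section calculus.
Context {R : realType} {n : nat}.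
Local Notation V := 'rV[R]_n.
Local Notation mu := (@lebesgue_measure_rV R n).
Implicit Types (h x y : V) (r t : R) (f g : V -> R).

(** The difference quotients on both sides are the same function, so the mean value theorem and the
    chain rule of one variable become available along lines. *)
Lemma is_derive_line f x (v : V) (u d : R) :
  is_derive (x + u *: v) v f d <-> is_derive u 1 (fun t => f (x + t *: v)) d.
Proof.
have E : (fun t : R => t^-1 *: ((f \o shift (x + u *: v)) (t *: v) - f (x + u *: v))) =
   (fun t : R => t^-1 *: (((fun s => f (x + s *: v)) \o shift u) (t *: 1) - f (x + u *: v))).
  apply/funext => t /=; congr (_ *: (f _ - _)).
  have e : t *: v + (x + u *: v) = x + (t * 1 + u) *: v.
    by rewrite mulr1 scalerDl addrCA.
  exact: e.
by split => -[]; rewrite /derivable /derive => d1 d2; split; rewrite /derivable /derive ?E// -?E.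
Qed.

(** The derivative is bounded only along the segment, since [integral_partial_eq0] applies this with
    a Gaussian bound that depends on x. *)
Lemma partial_mean_value f (i : 'I_n) (c : R) : (forall x, derivable f x (basis_rV i)) ->
  forall x t, (forall u, `|u| <= `|t| -> `|partial i f (x + u *: basis_rV i)| <= c) ->
  `|f (x + t *: basis_rV i) - f x| <= c * `|t|.
Proof.
move=> df x t ct; pose F u := f (x + u *: basis_rV i).
have dF (u : R) : is_derive u (1 : R) F (partial i f (x + u *: basis_rV i)).
  by apply/is_derive_line; split => //; exact: df.
have cF : continuous F.
  by move=> u; apply/differentiable_continuous/derivable1_diffP; case: (dF u).
have F0 : f x = F 0 by rewrite /F scale0r addr0.
rewrite F0 -/(F t); have [t0|/ltW t0] := leP 0 t.
  have [u + ->] := MVT_segment t0 (fun u _ => dF u) (continuous_subspaceT cF).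
  rewrite in_itv/= => /andP[u0 ut]; rewrite subr0 normrM ler_wpM2r//.
  by apply: ct; rewrite !ger0_norm.
have [u + e] := MVT_segment t0 (fun u _ => dF u) (continuous_subspaceT cF).
rewrite in_itv/= => /andP[ut u0]; rewrite distrC e sub0r normrM normrN ler_wpM2r//.
by apply: ct; rewrite !ler0_norm// lerN2.
Qed.

(** The displacement h is performed one coordinate at a time, which requires nothing beyond partial
    derivatives; each of the n steps costs at most [c |h|]. The induction runs over a list of
    coordinates with an arbitrary base point. *)
Lemma lipschitz_of_partial f (c : R) :
  (forall i x, derivable f x (basis_rV i)) ->
  (forall i x, `|partial i f x| <= c) ->
  forall x h, `|f (x + h) - f x| <= n%:R * c * enorm h.
Proof.
move=> df fc x h.
have key (s : seq 'I_n) y : `|f (y + \sum_(i <- s) h ord0 i *: basis_rV i) - f y| <=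
    \sum_(i <- s) c * `|h ord0 i|.
  elim: s y => [|i s IH] y; first by rewrite !big_nil addr0 subrr normr0.
  rewrite !big_cons addrA -(subrKA (f (y + h ord0 i *: basis_rV i))) [leRHS]addrC.
  apply: (le_trans (ler_normD _ _)); apply: lerD; first exact: IH.
  by apply: partial_mean_value => // u _.
rewrite {1}(_ : h = \sum_(i <- index_enum 'I_n) h ord0 i *: basis_rV i); last first.
  by rewrite {1}(row_sum_delta h).
apply: (le_trans (key _ _)).
apply: (@le_trans _ _ (\sum_(i < n) (c * enorm h))).
  apply: ler_sum => i _; rewrite ler_wpM2l ?coord_le_enorm//.
  by apply: le_trans (fc i x).
by rewrite sumr_const card_ord -[leLHS]mulr_natl mulrA.
Qed.

Lemma continuous_compact_support_bounded f (K : set V) : compact K -> continuous f ->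
  (forall x, ~ K x -> f x = 0) -> exists2 c, 0 <= c & forall x, `|f x| <= c.
Proof.
move=> cK cf f0.
have : compact (f @` K) by apply: continuous_compact => //; exact: continuous_subspaceT.
move=> /compact_bounded[M [Mr Mf]].
exists (`|M| + 1) => [|x]; first by rewrite addr_ge0.
have [Kx|/f0->] := pselect (K x); last by rewrite normr0 addr_ge0.
by apply: (Mf (`|M| + 1)); [rewrite (le_lt_trans (ler_norm _))// ltrDl|exists x].
Qed.

Lemma partial_eq0 f (i : 'I_n) (K : set V) : closed K ->
  (forall x, ~ K x -> f x = 0) -> forall x, ~ K x -> partial i f x = 0.
Proof.
move=> cK f0 x Kx; rewrite /partial (@near_eq_derive _ _ _ f (cst 0)) ?derive_cst//.
have : nbhs x (~` K) by apply: open_nbhs_nbhs; split => //; exact: closed_openC.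
by apply: filterS => y /= /f0.
Qed.

(* Majorant of the indicator function of the sup-norm ball of radius B. *)
Definition gauss_bump (B : R) x : R := expR (n%:R * B ^+ 2) * gauss_rV 1 x.

Lemma gauss_bump_ge0 B x : 0 <= gauss_bump B x.
Proof. by rewrite mulr_ge0 ?expR_ge0 ?gauss_rV_ge0. Qed.

Lemma gauss_bump_le B x : gauss_bump B x <= expR (n%:R * B ^+ 2).
Proof. by rewrite ler_piMr ?expR_ge0 ?gauss_rV_le1. Qed.

(** On the sup-norm ball [|x|^2 <= n B^2], which is the exponent of the prefactor. *)
Lemma gauss_bump_ge1 B x : (forall i, `|x ord0 i| <= B) -> 1 <= gauss_bump B x.
Proof.
move=> xB; rewrite /gauss_bump /gauss_rV -expRD -[leLHS]expR0 ler_expR mul1r subr_ge0.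
rewrite -[n in n%:R]card_ord mulr_natl -sumr_const ler_sum// => i _.
rewrite -expr2 -real_normK ?num_real// ler_sqr ?nnegrE//.
exact: le_trans (xB i).
Qed.

Lemma measurable_gauss_bump B : measurable_fun setT (gauss_bump B).
Proof. by apply: measurable_funM => //; exact: measurable_gauss_rV. Qed.

Lemma compact_subset_gauss_bump (K : set V) : compact K ->
  exists B, forall x, K x -> 1 <= gauss_bump B x.
Proof.
move=> /compact_bounded[M [Mr Mf]]; exists (`|M| + 1) => x Kx; apply: gauss_bump_ge1 => i.
apply: (@le_trans _ _ `|x|); last first.
  by apply: (Mf (`|M| + 1)) => //; rewrite (le_lt_trans (ler_norm _))// ltrDl.
by rewrite [leRHS]mx_normrE; apply: (@le_bigmax _ _ _ 0 (fun ij => `|x ij.1 ij.2|) (ord0, i)).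
Qed.

(** Since [(h_i + 2u)^2 >= 0], one has [|h + u e_i|^2 >= |h|^2/2 - 1]. This makes a Gaussian bound
    uniform along the segments of difference quotients. *)
Lemma gauss_rV_near h t u (i : 'I_n) : 0 <= t -> `|u| <= 1 ->
  gauss_rV t (h + u *: basis_rV i) <= expR t * gauss_rV (t / 2) h.
Proof.
move=> t0 u1; rewrite /gauss_rV dot_shift_basis -expRD ler_expR.
have u2 : u ^+ 2 <= 1 by rewrite -real_normK ?num_real// expr_le1.
have hi : h ord0 i ^+ 2 <= dot h h.
  rewrite /dot (bigD1 i)//= -expr2 lerDl sumr_ge0// => j _; rewrite -expr2 sqr_ge0//.
suff : t * (- (dot h h + (2 * u * h ord0 i + u ^+ 2))) <= t * (1 - dot h h / 2) by lra.
rewrite ler_wpM2l//.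
have := sqr_ge0 (h ord0 i + 2 * u); rewrite !expr2 in u2 hi *; lra.
Qed.

(* By translation invariance the difference quotients have integral zero; the
   Gaussian majorant allows passing to the limit by dominated convergence. *)
Lemma integral_partial_eq0 f (i : 'I_n) (c t : R) : 0 < t ->
  measurable_fun setT f -> (forall x, derivable f x (basis_rV i)) ->
  measurable_fun setT (partial i f) ->
  (forall x, `|f x| <= c * gauss_rV t x) ->
  (forall x, `|partial i f x| <= c * gauss_rV t x) ->
  (\int[mu]_x (partial i f x)%:E = 0)%E.
Proof.
move=> t0 mf df mp fc pc.
have c0 : 0 <= c.
  by have := le_trans (normr_ge0 _) (fc 0); rewrite pmulr_lge0// expR_gt0.
(* Dominated convergence is sequential, so the increment runs through [1/(k+1)]; it never exceeds 1,
   as [gauss_rV_near] requires. *)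
pose eta (k : nat) : R := harmonic k.
have eta0 k : 0 < eta k by rewrite /eta /harmonic/= invr_gt0.
pose fk k x := (f (x + eta k *: basis_rV i) - f x) / eta k.
have mshift k : measurable_fun setT (fun x => f (x + eta k *: basis_rV i)).
  have := @measurable_rV_shift R n (eta k *: basis_rV i) (EFin \o f).
  by move=> /(_ (measurableT_comp _ mf))/measurable_EFinP; apply.
have mfk k : measurable_fun setT (fk k).
  by apply: measurable_funM => //; apply: measurable_funB.
have intf := integrable_le_gauss t0 mf fc.
have intfk k : (\int[mu]_x (fk k x)%:E = 0)%E.
  have ish : mu.-integrable setT (EFin \o (fun x => f (x + eta k *: basis_rV i))).
    apply/integrableP; split; first exact/measurable_EFinP.
    have := @integral_rV_shift R n (eta k *: basis_rV i) (fun x => `|(f x)%:E|%E).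
    rewrite /= => ->; last by apply/measurable_EFinP; exact: measurableT_comp.
    by case/integrableP : intf.
  transitivity (\int[mu]_x ((eta k)^-1%:E * ((f (x + eta k *: basis_rV i))%:E - (f x)%:E)))%E.
    by apply: eq_integral => x _; rewrite -EFinB -EFinM mulrC.
  rewrite integralZl//; last exact: integrableB.
  rewrite integralB//.
  rewrite (@integral_rV_shift R n (eta k *: basis_rV i) (EFin \o f)).
    by rewrite subee ?mule0//; exact: integrable_fin_num.
  exact/measurable_EFinP.
have cvgfk x : (fk k x)%:E @[k --> \oo] --> (partial i f x)%:E.
  apply: cvg_EFin; first by near=> k.
  have h1 : (h^-1 *: ((f \o shift x) (h *: basis_rV i) - f x)) @[h --> 0^'] --> partial i f x.
    by have := df x; rewrite /derivable.
  have h2 : eta k @[k --> \oo] --> 0^'.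
    move=> P hP; have : \forall k \near \oo, eta k != 0 -> P (eta k).
      exact: (@cvg_harmonic R _ hP).
    by apply: filterS => k; apply; rewrite gt_eqF.
  rewrite (_ : fine \o _ = (fun h : R => h^-1 *: ((f \o shift x) (h *: basis_rV i) - f x)) \o eta).
    exact: cvg_comp h2 h1.
  apply/funext => k /=; rewrite /fk.
  have e : (f (x + eta k *: basis_rV i) - f x) / eta k =
      (eta k)^-1 * (f (eta k *: basis_rV i + x) - f x).
    by rewrite mulrC [x + _]addrC.
  exact: e.
have t20 : 0 < t / 2 by rewrite divr_gt0.
have eta1 k : eta k <= 1 by rewrite /eta /harmonic/= invf_le1 ?ltr0n// ler1n.
have fkle x k : (`|(fk k x)%:E| <= (c * expR t)%:E * (gauss_rV (t / 2) x)%:E)%E.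
  rewrite -EFinM /fk /= lee_fin normrM normfV ler_pdivrMr ?normr_gt0 ?gt_eqF//.
  apply: partial_mean_value => // u ue; apply: (le_trans (pc _)).
  rewrite -mulrA ler_wpM2l// gauss_rV_near//; first exact: ltW.
  by apply: (le_trans ue); rewrite ger0_norm// ltW.
have [_ _] := dominated_convergence measurableT
   (fun k => (measurable_EFinP _ _).2 (mfk k)) ((measurable_EFinP _ _).2 mp)
   (aeW mu (fun x _ => cvgfk x))
   (integrableZl measurableT (c * expR t) (integrable_gauss_rV t20))
   (aeW mu (fun x k _ => fkle x k)).
move=> H; apply: (cvg_unique _ H) => //.
rewrite (_ : (fun k => _) = cst 0%E); first exact: cvg_cst.
by apply/funext => k; exact: intfk.
Unshelve. all: by end_near. Qed.

Lemma is_derive_quadratic (a b d : R) :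
  is_derive (0 : R) (1 : R) (fun u : R => a + b * u + d * u ^+ 2) b.
Proof.
have -> : (fun u : R => a + b * u + d * u ^+ 2) =
    cst a + b *: (id : R -> R) + d *: ((id : R -> R) ^+ 2).
  by apply/funext => u; rewrite !fctE.
have d1 := is_deriveX 2 (is_derive_id (0 : R) (1 : R)).
have d2 := is_deriveD (is_deriveD (is_derive_cst a (0 : R) (1 : R))
  (is_deriveZ b (is_derive_id (0 : R) (1 : R)))) (is_deriveZ d d1).
apply: (is_derive_eq d2); rewrite /GRing.scale/= !mulr0 !mul0r mulr0 add0r addr0 mulr1//.
Qed.

Lemma is_derive_gauss_rV t h (i : 'I_n) :
  is_derive h (basis_rV i) (gauss_rV t) (- (2 * t * h ord0 i) * gauss_rV t h).
Proof.
have -> : h = h + (0 : R) *: basis_rV i by rewrite scale0r addr0.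
apply/is_derive_line; rewrite scale0r addr0.
pose p u : R := - (t * (dot h h + (2 * u * h ord0 i + u ^+ 2))).
rewrite (_ : (fun _ => _) = expR \o p); last first.
  by apply/funext => u /=; rewrite /gauss_rV dot_shift_basis.
have dp : is_derive (0 : R) (1 : R) p (- (2 * t * h ord0 i)).
  rewrite (_ : p = fun u => - (t * dot h h) + - (2 * t * h ord0 i) * u + (- t) * u ^+ 2).
    exact: is_derive_quadratic.
  by apply/funext => u; rewrite /p; ring.
have p0 : gauss_rV t h = expR (p 0) by rewrite /gauss_rV /p; congr expR; ring.
rewrite p0 mulrC; exact: is_derive1_comp.
Qed.

Lemma is_derive_shift f x h (v : V) d :
  is_derive (x + h) v f d -> is_derive h v (fun y => f (x + y)) d.
Proof.
move=> df; rewrite -[h]addr0 -[0](scale0r v); apply/is_derive_line.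
rewrite (_ : (fun _ => _) = (fun t : R => f ((x + h) + t *: v))); last first.
  by apply/funext => t; rewrite addrA.
by apply/is_derive_line; rewrite scale0r addr0.
Qed.

(** The Gaussian g of rate t satisfies [d_i g = - 2 t h_i g], so the difference of the two sides is,
    up to sign, the integral of the i-th partial derivative of [(f(x+h) - f(x)) g(h)], which
    vanishes. *)
Lemma gauss_integration_by_parts f (i : 'I_n) (c t : R) x : 0 < t ->
  measurable_fun setT f -> (forall y, derivable f y (basis_rV i)) ->
  measurable_fun setT (partial i f) ->
  (forall y, `|f y| <= c) -> (forall y, `|partial i f y| <= c) ->
  2 * t * \int[mu]_h (h ord0 i * (f (x + h) - f x) * gauss_rV t h) =
  \int[mu]_h (partial i f (x + h) * gauss_rV t h).
Proof.
move=> t0 mf df mp fc pc.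
have c0 : 0 <= c by exact: le_trans (fc 0).
pose G h := (f (x + h) - f x) * gauss_rV t h.
pose A h := partial i f (x + h) * gauss_rV t h.
pose B h := h ord0 i * (f (x + h) - f x) * gauss_rV t h.
have dG h : is_derive h (basis_rV i) G (A h - 2 * t * B h).
  have d1 : is_derive h (basis_rV i) (fun y => f (x + y)) (partial i f (x + h)).
    by apply: is_derive_shift; split => //; exact: df.
  have d2 := is_derive_gauss_rV t h i.
  rewrite (_ : G = ((fun y => f (x + y)) - cst (f x)) * gauss_rV t)//.
  by apply: is_derive_eq; rewrite /A /B !fctE /GRing.scale/=; ring.
have pG : partial i G = (fun h => A h - 2 * t * B h).
  by apply/funext => h; rewrite /partial; apply: derive_val.
have mx (g : V -> R) : measurable_fun setT g -> measurable_fun setT (fun h => g (x + h)).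
  move=> mg; have := @measurable_rV_shift R n x (EFin \o g).
  move=> /(_ (measurableT_comp _ mg))/measurable_EFinP.
  by under eq_fun do rewrite addrC; apply.
have mg := @measurable_gauss_rV R n t.
have mD : measurable_fun setT (fun h => f (x + h) - f x) by apply: measurable_funB => //; exact: mx.
have mA : measurable_fun setT A by apply: measurable_funM => //; exact: mx.
have mB : measurable_fun setT B.
  by apply: measurable_funM => //; apply: measurable_funM => //; exact: measurable_coord.
have Dc h : `|f (x + h) - f x| <= 2 * c.
  by apply: (le_trans (ler_normB _ _)); rewrite mulr_natl mulr2n lerD.
have gt2 h : gauss_rV t h <= gauss_rV (t / 2) h.
  by rewrite ler_expR lerN2; have := mulr_ge0 (ltW t0) (dot_ge0 h); lra.
have t20 : 0 < t / 2 by rewrite divr_gt0.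
(* This is [t^(-1/2)], in the form given by [enorm_gauss_le] at [r = ln t]. *)
pose k := expR (- (ln t / 2)).
have hg h : `|h ord0 i| * gauss_rV t h <= k * gauss_rV (t / 2) h.
  have := enorm_gauss_le (ln t) h; rewrite lnK ?posrE//; apply: le_trans.
  by rewrite ler_wpM2r ?gauss_rV_ge0 ?coord_le_enorm.
have Ac h : `|A h| <= c * gauss_rV (t / 2) h.
  by rewrite normrM [X in _ * X]ger0_norm ?gauss_rV_ge0// ler_pM ?gauss_rV_ge0.
have Bc h : `|B h| <= (2 * c * k) * gauss_rV (t / 2) h.
  rewrite 2!normrM [X in _ * X]ger0_norm ?gauss_rV_ge0// mulrAC mulrC -mulrA.
  by rewrite ler_pM ?mulr_ge0 ?gauss_rV_ge0.
have k0 : 0 <= k by exact: expR_ge0.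
have intA := integrable_le_gauss t20 mA Ac.
have intB := integrable_le_gauss t20 mB Bc.
(* One constant for two bounds: [2c] suffices for G, and [c + 2t (2ck)] for its derivative
   [A - 2t B]. *)
have := @integral_partial_eq0 G i (2 * c + c + 2 * t * (2 * c * k)) (t / 2) t20.
move=> H.
have {H} : (\int[mu]_x (partial i G x)%:E = 0)%E.
  apply: H.
  - exact: measurable_funM.
  - by move=> y; case: (dG y).
  - rewrite pG; apply: measurable_funB => //; exact: measurable_funM.
  - move=> h; rewrite /G normrM [X in _ * X]ger0_norm ?gauss_rV_ge0//.
    apply: ler_pM => //; first exact: gauss_rV_ge0.
    by apply: (le_trans (Dc h)); rewrite -addrA lerDl addr_ge0// !mulr_ge0// ltW.
  - move=> h; rewrite pG; apply: (le_trans (ler_normB _ _)).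
    rewrite [leRHS]mulrDl; apply: lerD.
      by apply: (le_trans (Ac h)); rewrite ler_wpM2r ?gauss_rV_ge0// lerDr mulr_ge0.
    have t2 : 0 <= 2 * t by rewrite mulr_ge0// ltW.
    by rewrite normrM (ger0_norm t2) -[leRHS]mulrA ler_wpM2l.
rewrite pG => /(congr1 fine) H.
have := @RintegralB _ _ _ mu setT A (fun h => 2 * t * B h) measurableT intA.
rewrite RintegralZl//= => HB; apply/esym/eqP; rewrite -subr_eq0 -HB.
  by apply/eqP; exact: H.
exact: (integrableZl measurableT (2 * t) intB).
Qed.

End calculus.

(** * Test fields *)

Section gauss_bump_bounds.
Context {R : realType} {n : nat}.
Local Notation V := 'rV[R]_n.
Local Notation mu := (@lebesgue_measure_rV R n).
Implicit Types (h x y : V) (r t c B : R) (f g : V -> R).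

(** Records a compactly supported C^1 function without mention of its support. The weighted bounds
    survive integration in x; in the Lipschitz bound the weight sits at both ends of the
    displacement, as either one may lie in the support. *)
Definition bump_bounded B c f :=
  [/\ forall x, `|f x| <= c * gauss_bump B x,
      forall x, `|f x| <= c &
      forall x h, `|f (x + h) - f x| <= c * enorm h * (gauss_bump B (x + h) + gauss_bump B x)].

Lemma bump_bounded_sum (I : finType) B (c : I -> R) (f : I -> V -> R) :
  (forall i, bump_bounded B (c i) (f i)) ->
  bump_bounded B (\sum_i c i) (fun x => \sum_i f i x).
Proof.
move=> bf; split=> [x|x|x h].
- rewrite mulr_suml; apply: (le_trans (ler_norm_sum _ _ _)).
  by apply: ler_sum => i _; case: (bf i).
- apply: (le_trans (ler_norm_sum _ _ _)).
  by apply: ler_sum => i _; case: (bf i).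
- rewrite -sumrB -mulrA mulr_suml; apply: (le_trans (ler_norm_sum _ _ _)).
  by apply: ler_sum => i _; rewrite mulrA; case: (bf i).
Qed.

Lemma bump_boundedW B c c' f : c <= c' -> bump_bounded B c f -> bump_bounded B c' f.
Proof.
move=> cc [f1 f2 f3]; split=> [x|x|x h].
- by apply: (le_trans (f1 x)); rewrite ler_wpM2r ?gauss_bump_ge0.
- exact: le_trans (f2 x) cc.
- by apply: (le_trans (f3 x h)); rewrite -!mulrA ler_wpM2r ?mulr_ge0 ?enorm_ge0 ?addr_ge0
  ?gauss_bump_ge0.
Qed.

(** If x or [x + h] lies in K the weight is at least 1 and the plain Lipschitz bound applies;
    otherwise both values vanish. The constant adds a bound of f, a bound d of all partial
    derivatives, and the Lipschitz constant [n d]. *)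
Lemma C1_compact_support_bump f (K : set V) B : compact K -> closed K ->
  (forall x, K x -> 1 <= gauss_bump B x) -> Ck 1 f -> (forall x, ~ K x -> f x = 0) ->
  exists c, [/\ 0 <= c, bump_bounded B c f & forall i x, `|partial i f x| <= c].
Proof.
move=> cK clK KB [cf df cpf] f0.
have [c1 c10 fc1] := continuous_compact_support_bounded cK cf f0.
have /choice[c2 c2P] : forall i, exists c, 0 <= c /\ forall x, `|partial i f x| <= c.
  move=> i.
  have [c c0 fc] := continuous_compact_support_bounded cK (cpf i) (partial_eq0 i clK f0).
  by exists c.
pose d := \sum_i c2 i.
have d0 : 0 <= d by apply: sumr_ge0 => i _; case: (c2P i).
have pd i x : `|partial i f x| <= d.
  apply: (le_trans ((c2P i).2 x)); rewrite /d (bigD1 i)//= lerDl sumr_ge0// => j _.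
  by case: (c2P j).
pose c := c1 + d + n%:R * d.
have nd0 : 0 <= n%:R * d by rewrite mulr_ge0.
have c1c : c1 <= c by rewrite /c -addrA lerDl addr_ge0.
have dc : d <= c by rewrite /c; lra.
have ndc : n%:R * d <= c by rewrite /c; lra.
have c0 : 0 <= c by exact: le_trans d0 dc.
exists c; split => //; last by move=> i x; exact: le_trans (pd i x) dc.
split=> [x|x|x h].
- have [Kx|/f0->] := pselect (K x); last by rewrite normr0 mulr_ge0 ?gauss_bump_ge0.
  apply: (le_trans (fc1 x)); apply: (le_trans c1c).
  by rewrite ler_peMr// KB.
- exact: le_trans (fc1 x) c1c.
- have lip : `|f (x + h) - f x| <= c * enorm h.
    apply: (le_trans (lipschitz_of_partial df pd x h)).
    by rewrite ler_wpM2r ?enorm_ge0.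
  have w1 : K x \/ K (x + h) -> 1 <= gauss_bump B (x + h) + gauss_bump B x.
    have := gauss_bump_ge0 B x; have := gauss_bump_ge0 B (x + h).
    by move=> b1 b2 [/KB|/KB] => b3; lra.
  have [/w1 w|/not_orP[/f0 -> /f0 ->]] := pselect (K x \/ K (x + h)).
    by apply: (le_trans lip); rewrite ler_peMr// mulr_ge0 ?enorm_ge0.
  by rewrite subrr normr0 !mulr_ge0 ?enorm_ge0 ?addr_ge0 ?gauss_bump_ge0.
Qed.

(** The second derivatives enter only here: they make the first ones, hence the divergence,
    Lipschitz. *)
Lemma Ck_partial f (K : set V) B i : compact K -> closed K ->
  (forall x, K x -> 1 <= gauss_bump B x) -> Ck 2 f -> (forall x, ~ K x -> f x = 0) ->
  exists c, [/\ 0 <= c, bump_bounded B c (partial i f) & continuous (partial i f)].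
Proof.
move=> cK clK KB [_ _ /(_ i) Ci] f0.
have [c [c0 bc _]] := C1_compact_support_bump cK clK KB Ci (partial_eq0 i clK f0).
by exists c; split => //; case: Ci.
Qed.

(** The estimates of the fractional divergence see a test field only through these bounds. B and c
    may depend on the field, because lower semicontinuity tests against one field at a time. *)
Record field_bounds (phi : V -> V) B c : Prop := FieldBounds {
  fb_ge0 : 0 <= c;
  fb_measurable : measurable_fun setT phi;
  fb_derivable : forall i x, derivable (fun y => phi y ord0 i) x (basis_rV i);
  fb_measurable_partial : forall i, measurable_fun setT (partial i (fun y => phi y ord0 i));
  fb_partial_le : forall i x, `|partial i (fun y => phi y ord0 i) x| <= c;
  fb_bump : forall i, bump_bounded B c (fun y => phi y ord0 i);
  fb_div : bump_bounded B c (divergence phi) }.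

Lemma Cinfty_c_field_bounds (Omega : set V) phi : Cinfty_c Omega phi ->
  exists B c, field_bounds phi B c.
Proof.
move=> [Cphi cK _]; have [B KB] := compact_subset_gauss_bump cK.
have clK : closed (supp phi) by exact: closed_closure.
have phi0 i x : ~ supp phi x -> phi x ord0 i = 0.
  move=> Kx; apply/eqP/negPn/negP => px; apply: Kx; apply: subset_closure => /=.
  by apply: contraNneq px => ->; rewrite mxE.
have /choice[c1 c1P] i := C1_compact_support_bump cK clK KB (Cphi i 1%N) (phi0 i).
have /choice[c2 c2P] i := Ck_partial i cK clK KB (Cphi i 2%N) (phi0 i).
pose c := \sum_i (c1 i + c2 i).
have cle i : c1 i + c2 i <= c.
  rewrite /c (bigD1 i)//= lerDl sumr_ge0// => j _.
  by case: (c1P j) => ? _ _; case: (c2P j) => ? _ _; rewrite addr_ge0.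
have c1le i : c1 i <= c.
  by apply: le_trans (cle i); case: (c2P i) => ? _ _; rewrite lerDl.
have c20 i : 0 <= c2 i by case: (c2P i).
have c10 i : 0 <= c1 i by case: (c1P i).
exists B, c; split.
- by apply: sumr_ge0 => i _; rewrite addr_ge0.
- apply: measurable_fun_rV => i; apply: continuous_measurable_rV.
  by case: (Cphi i 1%N).
- by move=> i x; case: (Cphi i 1%N).
- by move=> i; apply: continuous_measurable_rV; case: (c2P i).
- by move=> i x; case: (c1P i) => _ _ /(_ i x) /le_trans; apply.
- by move=> i; case: (c1P i) => _ /(bump_boundedW (c1le i)).
- have : bump_bounded B (\sum_i c2 i) (divergence phi).
    by apply: bump_bounded_sum => i; case: (c2P i).
  by apply: bump_boundedW; apply: ler_sum => i _; rewrite lerDr.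
Qed.

End gauss_bump_bounds.

Lemma Rintegral_sum_ord d (T : measurableType d) (R : realType)
    (mu : {measure set T -> \bar R}) n (f : 'I_n -> T -> R) :
  (forall i, mu.-integrable setT (EFin \o f i)) ->
  \int[mu]_x (\sum_i f i x) = \sum_i \int[mu]_x f i x.
Proof.
move=> intf; rewrite /Rintegral; under eq_integral do rewrite -sumEFin.
rewrite integral_sum// (eq_bigr (fun i => (fine (\int[mu]_x (f i x)%:E)%E)%:E)).
  by rewrite sumEFin.
by move=> i _; rewrite fineK//; apply: integrable_fin_num => //; exact: intf.
Qed.

(** * The fractional divergence as a mixture of Gaussian averages *)

Section representation.
Context {R : realType} {n : nat}.
Local Notation V := 'rV[R]_n.
Local Notation mu := (@lebesgue_measure_rV R n).
Local Notation leb := (@lebesgue_measure R).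
Implicit Types (h x y : V) (r t : R).
Variables (phi : V -> V) (B c : R) (fb : field_bounds phi B c).

Let P : R := expR (n%:R * B ^+ 2).

Definition dot_incr x h : R := dot h (phi (x + h) - phi x).

Lemma measurable_dot_incr d (T : measurableType d) (X H : T -> V) :
  measurable_fun setT X -> measurable_fun setT H ->
  measurable_fun setT (fun z => dot_incr (X z) (H z)).
Proof.
move=> mX mH; apply: measurable_dot => //.
apply: measurable_fun_rV => i; under eq_fun do rewrite !mxE.
have mp : measurable_fun setT (fun x : V => phi x ord0 i).
  exact: (measurableT_comp (measurable_coord i) (fb_measurable fb)).
apply: measurable_funB; apply: (measurableT_comp mp) => //.
exact: measurable_rVD.
Qed.

(** Of the three bounds on the numerator, this one keeps the weight needed for integration in x;
    [dot_incr_le2] is quadratic in h and serves narrow Gaussians, [dot_incr_le1] is linear and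
    serves wide ones. *)
Lemma dot_incr_le x h :
  `|dot_incr x h| <= n%:R * c * (gauss_bump B (x + h) + gauss_bump B x) * enorm h.
Proof.
rewrite -[n%:R * c * _]mulrA; apply: norm_dot_le => i; rewrite !mxE.
by case: (fb_bump fb i) => pb _ _; rewrite mulrDr (le_trans (ler_normB _ _))// lerD.
Qed.

Lemma dot_incr_le2 x h : `|dot_incr x h| <= 2 * n%:R * c * P * dot h h.
Proof.
rewrite -sqr_enorm; apply: (@le_trans _ _ (n%:R * (c * enorm h * (2 * P)) * enorm h)).
  apply: norm_dot_le => i; rewrite !mxE.
  case: (fb_bump fb i) => _ _ pb; apply: (le_trans (pb _ _)).
  rewrite ler_wpM2l ?mulr_ge0 ?enorm_ge0 ?(fb_ge0 fb)// mulr_natl mulr2n.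
  by rewrite lerD// gauss_bump_le.
by rewrite le_eqVlt; apply/orP; left; apply/eqP; rewrite expr2; ring.
Qed.

Lemma dot_incr_le1 x h : `|dot_incr x h| <= 2 * n%:R * c * P * enorm h.
Proof.
apply: (le_trans (dot_incr_le x h)); rewrite ler_wpM2r ?enorm_ge0//.
rewrite -[leRHS]mulrA [2 * n%:R]mulrC -!mulrA ler_wpM2l// mulrCA ler_wpM2l ?(fb_ge0 fb)//.
by rewrite mulr_natl mulr2n lerD// gauss_bump_le.
Qed.

(** The average [A_r(x)]. *)
Definition gauss_incr x r : R := \int[mu]_h (gauss_rV (expR r) h * dot_incr x h).

Lemma integrable_gauss_incr x r :
  mu.-integrable setT (EFin \o (fun h => gauss_rV (expR r) h * dot_incr x h)).
Proof.
have mF : measurable_fun setT (fun h => gauss_rV (expR r) h * dot_incr x h).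
  by apply: measurable_funM; [exact: measurable_gauss_rV|exact: measurable_dot_incr].
apply: (integrable_le_gauss (t := expR r / 2) (c := 2 * n%:R * c * P * expR (- (r / 2)))) => //.
  by rewrite divr_gt0// expR_gt0.
move=> h; rewrite normrM (ger0_norm (gauss_rV_ge0 _ _)) mulrC.
apply: (le_trans (ler_wpM2r (gauss_rV_ge0 _ _) (dot_incr_le1 x h))).
rewrite -!mulrA; do 4 (rewrite ler_wpM2l// ?expR_ge0 ?(fb_ge0 fb)//).
exact: enorm_gauss_le.
Qed.

Lemma measurable_divergence : measurable_fun setT (divergence phi).
Proof. by apply: measurable_sum => i; exact: fb_measurable_partial fb i. Qed.

Lemma gauss_incr_divergence x r :
  2 * expR r * gauss_incr x r = \int[mu]_h (divergence phi (x + h) * gauss_rV (expR r) h).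
Proof.
have er0 : 0 < expR r :> R by exact: expR_gt0.
have er20 : 0 < expR r / 2 by rewrite divr_gt0.
have mphi i : measurable_fun setT (fun x => phi x ord0 i).
  exact: (measurableT_comp (measurable_coord i) (fb_measurable fb)).
have mx (g : V -> R) : measurable_fun setT g -> measurable_fun setT (fun h => g (x + h)).
  move=> mg; apply: (measurableT_comp mg); exact: measurable_rVD.
have mg := @measurable_gauss_rV R n (expR r).
have intD i : mu.-integrable setT (EFin \o (fun h => partial i (fun y => phi y ord0 i) (x + h) *
  gauss_rV (expR r) h)).
  apply: (integrable_le_gauss (t := expR r) (c := c)) => //.
    by apply: measurable_funM => //; apply: mx; exact: fb_measurable_partial fb i.
  move=> h; rewrite normrM (ger0_norm (gauss_rV_ge0 _ _)) ler_wpM2r ?gauss_rV_ge0//.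
  exact: fb_partial_le fb i _.
have intI i : mu.-integrable setT (EFin \o (fun h => h ord0 i *
  (phi (x + h) ord0 i - phi x ord0 i) * gauss_rV (expR r) h)).
  apply: (integrable_le_gauss (t := expR r / 2) (c := 2 * c * expR (- (r / 2)))) => //.
    apply: measurable_funM => //; apply: measurable_funM; first exact: measurable_coord.
    by apply: measurable_funB => //; exact: (mx (fun y => phi y ord0 i)).
  move=> h; rewrite 2!normrM (ger0_norm (gauss_rV_ge0 _ _)) -[leRHS]mulrA.
  have pc : `|phi (x + h) ord0 i - phi x ord0 i| <= 2 * c.
    case: (fb_bump fb i) => _ pc _; apply: (le_trans (ler_normB _ _)).
    by rewrite mulr_natl mulr2n lerD.
  rewrite mulrAC mulrC ler_pM ?mulr_ge0 ?gauss_rV_ge0//.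
  apply: le_trans (enorm_gauss_le r h).
  by rewrite ler_wpM2r ?gauss_rV_ge0 ?coord_le_enorm.
transitivity (2 * expR r * \sum_i \int[mu]_h (h ord0 i * (phi (x + h) ord0 i - phi x ord0 i) *
  gauss_rV (expR r) h)).
  congr (_ * _); rewrite -Rintegral_sum_ord//; apply: eq_Rintegral => h _.
  rewrite /dot_incr /dot mulr_sumr; apply: eq_bigr => i _; rewrite !mxE mulrC//.
rewrite mulr_sumr.
transitivity (\sum_i \int[mu]_h (partial i (fun y => phi y ord0 i) (x + h) * gauss_rV (expR r) h)).
  apply: eq_bigr => i _.
  apply: (gauss_integration_by_parts (f := fun y => phi y ord0 i) (c := c)) => //.
  - exact: fb_derivable fb i.
  - exact: fb_measurable_partial fb i.
  - by case: (fb_bump fb i).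
  - exact: fb_partial_le fb i.
by rewrite -Rintegral_sum_ord//; apply: eq_Rintegral => h _; rewrite /divergence mulr_suml.
Qed.

(** For [r >= 0] the gain [e^(-r)] comes from dividing by [2 e^r] in the integration by parts. *)
Definition low_weight r : R := if r < 0 then 1 else expR (- r).

(* The factor of [div phi(x)] in the leading term of [gauss_incr x r]; for r < 0 no
   leading term is extracted, since [gauss_incr x r] is itself an admissible error. *)
Definition gauss_mean r : R :=
  if r < 0 then 0 else (Num.sqrt pi ^+ n / 2) * expR (- ((n%:R + 2) * r / 2)).

(** Both regimes end in the same error integral: for [r < 0] through the size of the increments of
    phi, with constant [n c]; for [r >= 0] through the weighted Lipschitz bound of the divergence,
    with constant [c e^(-r) / 2]. The factor [(n+1) c] covers both. *)
Lemma gauss_incr_approx x r :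
  (`|gauss_incr x r - gauss_mean r * divergence phi x|%:E <=
   ((n%:R + 1) * c * low_weight r)%:E *
   \int[mu]_h (enorm h * gauss_rV (expR r) h * (gauss_bump B (x + h) + gauss_bump B x))%:E)%E.
Proof.
have c0 := fb_ge0 fb.
have mw : measurable_fun setT (fun h => gauss_bump B (x + h) + gauss_bump B x).
  apply: measurable_funD => //.
  apply: (measurableT_comp (@measurable_gauss_bump R n B)); exact: measurable_rVD.
have w0 h : 0 <= gauss_bump B (x + h) + gauss_bump B x by rewrite addr_ge0 ?gauss_bump_ge0.
have me : measurable_fun setT (@enorm R n) by exact: measurable_enorm.
have mg := @measurable_gauss_rV R n (expR r).
have mI : measurable_fun setT (fun h => (enorm h * gauss_rV (expR r) h *
  (gauss_bump B (x + h) + gauss_bump B x))%:E).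
  by apply/measurable_EFinP; apply: measurable_funM => //; exact: measurable_funM.
have I0 h : (0 <= (enorm h * gauss_rV (expR r) h * (gauss_bump B (x + h) + gauss_bump B x))%:E)%E.
  by rewrite lee_fin !mulr_ge0 ?enorm_ge0 ?gauss_rV_ge0.
have key (f : V -> R) (k : R) : 0 <= k -> k <= (n%:R + 1) * c * low_weight r ->
    mu.-integrable setT (EFin \o f) ->
    (forall h, `|f h| <= k * (enorm h * gauss_rV (expR r) h *
      (gauss_bump B (x + h) + gauss_bump B x))) ->
    (`|\int[mu]_h f h|%:E <= ((n%:R + 1) * c * low_weight r)%:E *
   \int[mu]_h (enorm h * gauss_rV (expR r) h * (gauss_bump B (x + h) + gauss_bump B x))%:E)%E.
  move=> k0 kc intf fk; rewrite EFin_normr_Rintegral//.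
  have mf : measurable_fun setT f by apply/measurable_EFinP; case/integrableP : intf.
  apply: (le_trans (le_abse_integral _ _ _)) => //; first exact/measurable_EFinP.
  rewrite -ge0_integralZl//; last by rewrite lee_fin (le_trans k0).
  apply: ge0_le_integral => //.
  - by apply: measurableT_comp => //; exact/measurable_EFinP.
  - by apply/measurable_EFinP; apply: measurable_funM => //; exact/measurable_EFinP.
  - move=> h _; rewrite -EFinM lee_fin; apply: (le_trans (fk h)).
    by rewrite ler_wpM2r// -lee_fin.
rewrite /low_weight /gauss_mean in key *; case: ltP key => r0 key.
  rewrite mul0r subr0; apply: (key _ (n%:R * c)).
  - by rewrite mulr_ge0.
  - by rewrite mulr1 ler_wpM2r// lerDl.
  - exact: integrable_gauss_incr.
  - move=> h; rewrite normrM (ger0_norm (gauss_rV_ge0 _ _)) mulrC.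
    apply: (le_trans (ler_wpM2r (gauss_rV_ge0 _ _) (dot_incr_le x h))).
    by rewrite le_eqVlt; apply/orP; left; apply/eqP; ring.
case: (fb_div fb) => gB gc gl.
have intg : mu.-integrable setT (EFin \o (fun h => divergence phi (x + h) * gauss_rV (expR r) h)).
  apply: (integrable_le_gauss (t := expR r) (c := c)) => //; first exact: expR_gt0.
    apply: measurable_funM => //.
    by apply: (measurableT_comp measurable_divergence); exact: measurable_rVD.
  by move=> h; rewrite normrM (ger0_norm (gauss_rV_ge0 _ _)) ler_wpM2r ?gauss_rV_ge0.
have intc : mu.-integrable setT (EFin \o (fun h => divergence phi x * gauss_rV (expR r) h)).
  exact: (integrableZl measurableT (divergence phi x) (integrable_gauss_rV (expR_gt0 r))).
have intB : mu.-integrable setT (EFin \o (fun h => divergence phi (x + h) * gauss_rV (expR r) h -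
  divergence phi x * gauss_rV (expR r) h)).
  exact: (integrableB measurableT intg intc).
(* The coefficient of [divergence phi x] is [e^(-r)/2] times the total Gaussian mass
   [pi^(n/2) e^(-n r/2)]. *)
have -> : gauss_incr x r - Num.sqrt pi ^+ n / 2 * expR (- ((n%:R + 2) * r / 2)) * divergence phi x =
    \int[mu]_h ((expR (- r) / 2) * (divergence phi (x + h) * gauss_rV (expR r) h - divergence phi
      x * gauss_rV (expR r) h)).
  rewrite RintegralZl// RintegralB// RintegralZl//; last exact: integrable_gauss_rV (expR_gt0 r).
  rewrite -gauss_incr_divergence /Rintegral integral_gauss_expR /=.
  rewrite mulrBr; congr (_ - _).
    rewrite !mulrA -[expR (- r) / 2 * 2]mulrA mulVf// mulr1 -expRD addNr expR0 mul1r//.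
  rewrite (_ : - ((n%:R + 2) * r / 2) = - r + - (n%:R * r / 2)); last by field.
  by rewrite expRD; field.
apply: (key _ (expR (- r) / 2 * c)).
- by rewrite !mulr_ge0 ?expR_ge0.
- have h1 : 0 <= c * expR (- r) by rewrite mulr_ge0 ?expR_ge0.
  by have := mulr_ge0 (ler0n R n) h1; lra.
- exact: (integrableZl measurableT _ intB).
- move=> h; rewrite normrM (@ger0_norm _ (expR (- r) / 2)) ?mulr_ge0 ?expR_ge0//.
  rewrite -[leRHS]mulrA ler_wpM2l ?mulr_ge0 ?expR_ge0// -mulrBl normrM
    (ger0_norm (gauss_rV_ge0 _ _)).
  apply: (le_trans (ler_wpM2r (gauss_rV_ge0 _ _) (gl x h))).
  by rewrite le_eqVlt; apply/orP; left; apply/eqP; ring.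
Qed.

(** * Fubini's theorem for a fixed exponent alpha *)

Section alpha.
Variable alpha : R.
Hypothesis alpha01 : 0 < alpha < 1.

Let s : R := (n%:R + alpha + 1) / 2.
Let eps : R := (1 - alpha) / 2.

(** Integrated in r it gives [Gamma s] times the fractional integrand, integrated in h it gives
    [e^(s r) A_r(x)]. *)
Let F x (p : measurableTypeR R * V) : R :=
  expR (s * p.1) * (gauss_rV (expR p.1) p.2 * dot_incr x p.2).

Lemma measurable_gauss_expR d (T : measurableType d) (f : T -> R) (H : T -> V) :
  measurable_fun setT f -> measurable_fun setT H ->
  measurable_fun setT (fun z => gauss_rV (expR (f z)) (H z)).
Proof.
move=> mf mH; do 2 (apply: measurableT_comp => //).
by apply: measurable_funM; [exact: measurableT_comp|exact: measurable_dot].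
Qed.

Let measurable_F x : measurable_fun setT (F x).
Proof.
apply: measurable_funM.
  by apply: measurableT_comp => //; apply: measurable_funM => //; exact: measurable_fst.
apply: measurable_funM.
  by apply: measurable_gauss_expR; [exact: measurable_fst|exact: measurable_snd].
by apply: measurable_dot_incr => //; exact: measurable_snd.
Qed.

(** The linear bound on the increment leaves the exponent [s - (n+1)/2 = alpha/2] for [r < 0], the
    quadratic one [s - (n+2)/2 = -eps] for [r >= 0]. Integrability in r is thus the condition
    [0 < alpha < 1]. *)
Let integral_abs_F x r : (\int[mu]_h `|(F x (r, h))%:E| <=
  (2 * n%:R * c * P * (2 * Num.sqrt (2 * pi) ^+ n) * two_sided_expR (alpha / 2) eps r)%:E)%E.
Proof.
set C := 2 * n%:R * c * P.
have C0 : 0 <= C by rewrite !mulr_ge0 ?expR_ge0 ?(fb_ge0 fb).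
have mFr : measurable_fun setT (fun h => `|(F x (r, h))%:E|%E).
  apply: measurableT_comp => //; apply/measurable_EFinP.
  exact: (measurableT_comp (measurable_F x) (pair1_measurable _)).
have S0 : 0 <= Num.sqrt (2 * pi) ^+ n :> R by rewrite exprn_ge0 ?sqrtr_ge0.
rewrite /two_sided_expR; case: ltP => r0.
  apply: (@le_trans _ _ (\int[mu]_h ((expR (s * r) * C)%:E *
    (enorm h * gauss_rV (expR r) h)%:E))%E).
    apply: ge0_le_integral => //.
    - apply/measurable_EFinP; apply: measurable_funM => //.
      by apply: measurable_funM; [exact: measurable_enorm|exact: measurable_gauss_rV].
    - move=> h _; rewrite -EFinM /= lee_fin /F /= !normrM (ger0_norm (expR_ge0 _)).
      rewrite -[leRHS]mulrA ler_wpM2l ?expR_ge0// (ger0_norm (gauss_rV_ge0 _ _)).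
      by rewrite [leRHS]mulrA [leLHS]mulrC ler_wpM2r ?gauss_rV_ge0 ?dot_incr_le1.
  rewrite ge0_integralZl//.
  - apply: (le_trans (lee_wpmul2l _ (integral_enorm_gauss r))).
      by rewrite lee_fin mulr_ge0 ?expR_ge0.
    rewrite -EFinM lee_fin (_ : alpha / 2 * r = s * r + - ((n%:R + 1) * r / 2)); last first.
      by rewrite /s; field.
    rewrite expRD; move: (expR _) (expR (- _)) (expR_ge0 (s * r))
      (expR_ge0 (- ((n%:R + 1) * r / 2))) => a b a0 b0.
    rewrite (_ : a * C * _ = C * (Num.sqrt (2 * pi) ^+ n) * (a * b)); last by ring.
    by rewrite ler_wpM2r ?mulr_ge0// ler_wpM2l//; move: S0; lra.
  - apply/measurable_EFinP.
    by apply: measurable_funM; [exact: measurable_enorm|exact: measurable_gauss_rV].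
  - by move=> h _; rewrite lee_fin mulr_ge0 ?enorm_ge0 ?gauss_rV_ge0.
  - by rewrite lee_fin mulr_ge0 ?expR_ge0.
apply: (@le_trans _ _ (\int[mu]_h ((expR (s * r) * C)%:E * (dot h h * gauss_rV (expR r) h)%:E))%E).
  apply: ge0_le_integral => //.
  - apply/measurable_EFinP; apply: measurable_funM => //.
    by apply: measurable_funM; [exact: measurable_dot|exact: measurable_gauss_rV].
  - move=> h _; rewrite -EFinM /= lee_fin /F /= !normrM (ger0_norm (expR_ge0 _)).
    rewrite -[leRHS]mulrA ler_wpM2l ?expR_ge0// (ger0_norm (gauss_rV_ge0 _ _)).
    by rewrite [leRHS]mulrA [leLHS]mulrC ler_wpM2r ?gauss_rV_ge0 ?dot_incr_le2.
rewrite ge0_integralZl//.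
- apply: (le_trans (lee_wpmul2l _ (integral_dot_gauss r))).
    by rewrite lee_fin mulr_ge0 ?expR_ge0.
  rewrite -EFinM lee_fin (_ : - (eps * r) = s * r + - ((n%:R + 2) * r / 2)); last first.
    by rewrite /s /eps; field.
  rewrite expRD le_eqVlt; apply/orP; left; apply/eqP; ring.
- apply/measurable_EFinP.
  by apply: measurable_funM; [exact: measurable_dot|exact: measurable_gauss_rV].
- by move=> h _; rewrite lee_fin mulr_ge0 ?dot_ge0 ?gauss_rV_ge0.
- by rewrite lee_fin mulr_ge0 ?expR_ge0.
Qed.

Let integrable_F x : (leb \x mu)%E.-integrable setT (EFin \o F x).
Proof.
apply/integrable12ltyP; first exact/measurable_EFinP.
have eps0 : 0 < eps by rewrite /eps divr_gt0//; case/andP: alpha01 => _; rewrite subr_gt0.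
have a0 : 0 < alpha / 2 by rewrite divr_gt0//; case/andP: alpha01.
set C := 2 * n%:R * c * P * (2 * Num.sqrt (2 * pi) ^+ n).
have C0 : 0 <= C by rewrite !mulr_ge0 ?expR_ge0 ?(fb_ge0 fb)// exprn_ge0 ?sqrtr_ge0.
apply: (@le_lt_trans _ _ (\int[leb]_r (C%:E * (two_sided_expR (alpha / 2) eps r)%:E))%E).
  apply: ge0_le_integral => //.
  - by move=> r _; exact: integral_ge0.
  - apply: (measurable_fun_fubini_tonelli_F (m2 := mu) (fun p => `|(F x p)%:E|%E)) => //.
    by apply: measurableT_comp => //; exact/measurable_EFinP.
  - by apply/measurable_EFinP; apply: measurable_funM => //; exact: measurable_two_sided_expR.
  - by move=> r _; rewrite -EFinM; exact: integral_abs_F.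
rewrite ge0_integralZl//.
- by rewrite integral_two_sided_expR// -EFinM ltry.
- by apply/measurable_EFinP; exact: measurable_two_sided_expR.
- by move=> r _; rewrite lee_fin two_sided_expR_ge0.
Qed.

Let dot_incr0 x : dot_incr x 0 = 0.
Proof. by rewrite /dot_incr addr0 subrr /dot big1// => i _; rewrite mxE mul0r. Qed.

Let integral_F_inner x h : (\int[leb]_r (F x (r, h))%:E =
  (Gamma s * (dot_incr x h / enorm h `^ (n%:R + alpha + 1)))%:E)%E.
Proof.
have s0 : 0 < s by case/andP: alpha01 => a0 _; rewrite /s divr_gt0// ltr_wpDl// addr_ge0// ltW.
(* At [h = 0] Euler's integral diverges, but the increment vanishes and both sides are 0. *)
have [->|hn0] := eqVneq h 0.
  rewrite dot_incr0 mul0r mulr0; apply: integral0_eq => r _.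
  by rewrite /F /= dot_incr0 !mulr0.
have d0 : 0 < dot h h.
  by rewrite -sqr_enorm exprn_gt0// lt_neqAle enorm_ge0 andbT eq_sym enorm_eq0.
have dE : dot h h `^ s = enorm h `^ (n%:R + alpha + 1).
  rewrite -sqr_enorm -powR_mulrn ?enorm_ge0// -powRrM; congr (_ `^ _).
  by rewrite /s; field.
transitivity (\int[leb]_r ((dot_incr x h)%:E * (expR (s * r - expR r * dot h h))%:E))%E.
  apply: eq_integral => r _; rewrite -EFinM /F /gauss_rV /= expRD; congr EFin; ring.
rewrite integralZl//; last first.
  apply/integrableP; split; first by apply/measurable_EFinP; exact: measurable_gamma_kernel.
  under eq_integral => r _ do rewrite /= (ger0_norm (expR_ge0 _)).
  by rewrite integral_gamma_kernel// ltry.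
rewrite integral_gamma_kernel// -EFinM dE; congr EFin; ring.
Qed.

Let integral_F_outer x r : (\int[mu]_h (F x (r, h))%:E = (expR (s * r) * gauss_incr x r)%:E)%E.
Proof.
have intg := integrable_gauss_incr x r.
rewrite /gauss_incr -RintegralZl// /Rintegral fineK//.
apply: integrable_fin_num => //; exact: (integrableZl measurableT (expR (s * r)) intg).
Qed.

Lemma integrable_expR_gauss_incr x :
  leb.-integrable setT (fun r => (expR (s * r) * gauss_incr x r)%:E).
Proof.
have := integrable_fubini_F (integrable_F x).
by congr (_.-integrable _ _); apply/funext => r; exact: integral_F_outer.
Qed.

Lemma Gamma_frac_integral x :
  Gamma s * \int[mu]_y (dot (y - x) (phi y - phi x) / enorm (y - x) `^ (n%:R + alpha + 1)) =
  \int[leb]_r (expR (s * r) * gauss_incr x r).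
Proof.
have s0 : 0 < s by case/andP: alpha01 => a0 _; rewrite /s divr_gt0// ltr_wpDl// addr_ge0// ltW.
pose X h := dot_incr x h / enorm h `^ (n%:R + alpha + 1).
have mX : measurable_fun setT X.
  apply: measurable_funM; first exact: measurable_dot_incr.
  under eq_fun do rewrite -powRN.
  apply: (measurableT_comp (f := fun z : R => z `^ (- (n%:R + alpha + 1)))).
    exact: measurable_powR.
  exact: measurable_enorm.
have -> : \int[mu]_y (dot (y - x) (phi y - phi x) / enorm (y - x) `^ (n%:R + alpha + 1)) =
  \int[mu]_h X h.
  rewrite /Rintegral -(integral_rV_shift (- x) (f := EFin \o X)); last exact/measurable_EFinP.
  by congr fine; apply: eq_integral => y _; rewrite /X /dot_incr /= [x + (y - x)]addrC subrK.
(* Integrability of the fractional integrand is a by-product of that of F; it is what allows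
   [Gamma s] to move inside the integral. *)
have intGX : mu.-integrable setT (EFin \o (fun h => Gamma s * X h)).
  have mS : measurable_fun setT (fun p : V * measurableTypeR R => (F x (p.2, p.1))%:E).
    apply/measurable_EFinP; apply: (measurableT_comp (measurable_F x)).
    by apply: measurable_fun_pair; [exact: measurable_snd|exact: measurable_fst].
  have mFE : measurable_fun setT (EFin \o F x) by exact/measurable_EFinP.
  have /(integrable12ltyP mu leb mS)/integrable_fubini_F :=
    (integrable21ltyP leb mu mFE).1 (integrable_F x).
  by congr (_.-integrable _ _); apply/funext => h; exact: integral_F_inner.
have intX : mu.-integrable setT (EFin \o X).
  have := integrableZl measurableT (Gamma s)^-1 intGX.
  congr (_.-integrable _ _); apply/funext => h /=.
  by rewrite -EFinM mulKf// gt_eqF// Gamma_gt0.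
rewrite -RintegralZl// /Rintegral; congr fine.
have := Fubini (integrable_F x) => /=.
under eq_integral do rewrite integral_F_outer.
by move=> ->; apply: eq_integral => h _; rewrite -integral_F_inner.
Qed.

End alpha.

End representation.

(** The function is [fine] of a difference of two Tonelli integrals, hence measurable even across
    parameters where the integral is infinite. *)
Lemma measurable_Rintegral d1 d2 (T1 : measurableType d1) (T2 : measurableType d2)
    (R : realType) (m2 : {sigma_finite_measure set T2 -> \bar R}) (f : T1 * T2 -> R) :
  measurable_fun setT f -> measurable_fun setT (fun x => \int[m2]_y f (x, y)).
Proof.
move=> mf; have mE : measurable_fun setT (EFin \o f) by exact/measurable_EFinP.
apply: (measurableT_comp (f := @fine R)) => //.
rewrite (_ : (fun x => _) = (fun x => \int[m2]_y ((EFin \o f)^\+ (x, y)) - \int[m2]_y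
  ((EFin \o f)^\- (x, y)))%E).
  apply: emeasurable_funB.
    apply: (measurable_fun_fubini_tonelli_F (m2 := m2) ((EFin \o f)^\+)%E) => //.
    exact: measurable_funepos.
  apply: (measurable_fun_fubini_tonelli_F (m2 := m2) ((EFin \o f)^\-)%E) => //.
  exact: measurable_funeneg.
apply/funext => x; rewrite [LHS]integralE; congr (_ - _)%E.
  by apply: eq_integral => y _; rewrite !funeposE.
by apply: eq_integral => y _; rewrite !funenegE.
Qed.

(** * Convergence of the fractional divergence *)

Section estimate.
Context {R : realType} {n : nat}.
Local Notation V := 'rV[R]_n.
Local Notation mu := (@lebesgue_measure_rV R n).
Local Notation leb := (@lebesgue_measure R).
Implicit Types (h x y : V) (r t : R).
Variables (phi : V -> V) (B c : R) (fb : field_bounds phi B c).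

Let P : R := expR (n%:R * B ^+ 2).
Let S : R := Num.sqrt (2 * pi) ^+ n.
(** M exceeds both the bound P of the bump and its integral [P pi^(n/2)], so sup and L^1 estimates
    share their constants. *)
Let M : R := P * (1 + Num.sqrt pi ^+ n).

Let S0 : 0 <= S. Proof. by rewrite exprn_ge0 ?sqrtr_ge0. Qed.

Let P0 : 0 <= P. Proof. exact: expR_ge0. Qed.

Let PM : P <= M.
Proof. by rewrite /M mulrDr mulr1 lerDl mulr_ge0// exprn_ge0 ?sqrtr_ge0. Qed.

Lemma integral_gauss_bump : (\int[mu]_x (gauss_bump B x)%:E = (P * Num.sqrt pi ^+ n)%:E)%E.
Proof.
under eq_integral do rewrite EFinM.
rewrite ge0_integralZl//; first by rewrite integral_gauss_rV// -EFinM divr1.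
- by apply/measurable_EFinP; exact: measurable_gauss_rV.
- by move=> h _; rewrite lee_fin gauss_rV_ge0.
Qed.

Let integral_bump_le : (\int[mu]_x (gauss_bump B x)%:E <= M%:E)%E.
Proof. by rewrite integral_gauss_bump lee_fin /M mulrDr lerDr mulr1. Qed.

Definition spread_kernel r x h : R :=
  enorm h * gauss_rV (expR r) h * (gauss_bump B (x + h) + gauss_bump B x).

Lemma spread_kernel_ge0 r x h : 0 <= spread_kernel r x h.
Proof. by rewrite !mulr_ge0 ?enorm_ge0 ?gauss_rV_ge0 ?addr_ge0 ?gauss_bump_ge0. Qed.

Lemma measurable_spread_kernel d (T : measurableType d) (f : T -> R) (X H : T -> V) :
  measurable_fun setT f -> measurable_fun setT X -> measurable_fun setT H ->
  measurable_fun setT (fun z => spread_kernel (f z) (X z) (H z)).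
Proof.
move=> mf mX mH; apply: measurable_funM.
  by apply: measurable_funM; [exact: measurable_enorm|exact: measurable_gauss_expR].
apply: measurable_funD; apply: (measurableT_comp (@measurable_gauss_bump R n B)) => //.
exact: measurable_rVD.
Qed.

Definition spread r x : \bar R := (\int[mu]_h (spread_kernel r x h)%:E)%E.

Lemma spread_ge0 r x : (0 <= spread r x)%E.
Proof. by apply: integral_ge0 => h _; rewrite lee_fin spread_kernel_ge0. Qed.

Lemma measurable_spread d (T : measurableType d) (f : T -> R) (X : T -> V) :
  measurable_fun setT f -> measurable_fun setT X ->
  measurable_fun setT (fun z => spread (f z) (X z)).
Proof.
move=> mf mX.
apply: (measurable_fun_fubini_tonelli_F (m2 := mu)
  (fun p : T * V => (spread_kernel (f p.1) (X p.1) p.2)%:E)).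
  apply/measurable_EFinP; apply: measurable_spread_kernel => //.
  - by apply: (measurableT_comp mf).
  - by apply: (measurableT_comp mX).
by move=> p; rewrite lee_fin spread_kernel_ge0.
Qed.

Let decay r : R := expR (- ((n%:R + 1) * r / 2)).

Lemma spread_le r x : (spread r x <= (2 * M * S * decay r)%:E)%E.
Proof.
have M0 : 0 <= M by exact: le_trans PM.
apply: (@le_trans _ _ (\int[mu]_h ((2 * M)%:E * (enorm h * gauss_rV (expR r) h)%:E))%E).
  apply: ge0_le_integral => //.
  - by move=> h _; rewrite lee_fin spread_kernel_ge0.
  - by apply/measurable_EFinP; exact: measurable_spread_kernel.
  - apply/measurable_EFinP; apply: measurable_funM => //.
    by apply: measurable_funM; [exact: measurable_enorm|exact: measurable_gauss_rV].
  - move=> h _; rewrite -EFinM lee_fin /spread_kernel [leRHS]mulrC ler_wpM2l ?mulr_ge0 ?enorm_ge0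
    ?gauss_rV_ge0//.
    by rewrite mulr_natl mulr2n lerD// (le_trans (gauss_bump_le _ _)).
rewrite ge0_integralZl//.
- apply: (le_trans (lee_wpmul2l _ (integral_enorm_gauss r))); first by rewrite lee_fin mulr_ge0.
  by rewrite -EFinM lee_fin mulrA.
- apply/measurable_EFinP.
  by apply: measurable_funM; [exact: measurable_enorm|exact: measurable_gauss_rV].
- by move=> h _; rewrite lee_fin mulr_ge0 ?enorm_ge0 ?gauss_rV_ge0.
- by rewrite lee_fin mulr_ge0.
Qed.

(** After exchanging the integrals, translation invariance bounds the x-integral of each bump by M
    whatever h is; the rest is the computation of the pointwise bound. *)
Lemma integral_spread_le r : (\int[mu]_x spread r x <= (2 * M * S * decay r)%:E)%E.
Proof.
have M0 : 0 <= M by exact: le_trans PM.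
rewrite /spread (fubini_tonelli (m1 := mu) (m2 := mu) (fun p => (spread_kernel r p.1 p.2)%:E));
  last 2 first.
- by apply/measurable_EFinP; apply: measurable_spread_kernel.
- by move=> p; rewrite lee_fin spread_kernel_ge0.
have mb := @measurable_gauss_bump R n B.
have mE : measurable_fun setT (EFin \o @gauss_bump R n B) by exact/measurable_EFinP.
apply: (@le_trans _ _ (\int[mu]_h ((2 * M)%:E * (enorm h * gauss_rV (expR r) h)%:E))%E).
  apply: ge0_le_integral => //.
  - by move=> h _; apply: integral_ge0 => x _; rewrite lee_fin spread_kernel_ge0.
  - apply: (measurable_fun_fubini_tonelli_G (m1 := mu)
    (fun p : V * V => (spread_kernel r p.1 p.2)%:E)).
      by apply/measurable_EFinP; apply: measurable_spread_kernel.
    by move=> p; rewrite lee_fin spread_kernel_ge0.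
  - apply/measurable_EFinP; apply: measurable_funM => //.
    by apply: measurable_funM; [exact: measurable_enorm|exact: measurable_gauss_rV].
  - move=> h _; have e0 : 0 <= enorm h * gauss_rV (expR r) h by rewrite mulr_ge0 ?enorm_ge0
    ?gauss_rV_ge0.
    have msh : measurable_fun setT (fun x => (gauss_bump B (x + h))%:E) by exact:
      measurable_rV_shift mE.
    rewrite /spread_kernel; under eq_integral do rewrite /= EFinM EFinD.
    rewrite ge0_integralZl//; last 2 first.
    + by apply: emeasurable_funD.
    + by move=> x _; rewrite -EFinD lee_fin addr_ge0 ?gauss_bump_ge0.
    rewrite muleC lee_wpmul2r ?lee_fin// ge0_integralD//; last 2 first.
    + by move=> x _; rewrite lee_fin gauss_bump_ge0.
    + by move=> x _; rewrite lee_fin gauss_bump_ge0.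
    rewrite (integral_rV_shift h mE).
    by rewrite mulr_natl mulr2n EFinD; apply: leeD.
rewrite ge0_integralZl//.
- apply: (le_trans (lee_wpmul2l _ (integral_enorm_gauss r))); first by rewrite lee_fin mulr_ge0.
  by rewrite -EFinM lee_fin mulrA.
- apply/measurable_EFinP.
  by apply: measurable_funM; [exact: measurable_enorm|exact: measurable_gauss_rV].
- by move=> h _; rewrite lee_fin mulr_ge0 ?enorm_ge0 ?gauss_rV_ge0.
- by rewrite lee_fin mulr_ge0.
Qed.

(** * Estimates uniform in alpha between 1/2 and 1 *)

Section alpha.
Variable alpha : R.
Hypotheses (alpha_ge : 1 / 2 <= alpha) (alpha_lt1 : alpha < 1).

Let s : R := (n%:R + alpha + 1) / 2.
Let eps : R := (1 - alpha) / 2.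

Let eps0 : 0 < eps. Proof. by rewrite /eps divr_gt0// subr_gt0. Qed.

Let alpha01 : 0 < alpha < 1. Proof. by rewrite alpha_lt1 andbT; move: alpha_ge; lra. Qed.

(** The rates [alpha/2] and [1 - alpha/2] stay away from 0 as alpha tends to 1, so the errors remain
    bounded; the leading term decays only at rate eps and its integral grows like [1/eps]. This gap
    is what lets kappa remove the errors alone. *)
Let weight_decay r : expR (s * r) * low_weight r * decay r =
  two_sided_expR (alpha / 2) (1 - alpha / 2) r.
Proof.
rewrite /low_weight /two_sided_expR /decay /s; case: ifP => _.
  by rewrite mulr1 -expRD; congr expR; field.
by rewrite -!expRD; congr expR; field.
Qed.

Lemma measurable_low_weight : measurable_fun setT (@low_weight R).
Proof.
apply: measurable_fun_ifT => //; first exact: measurable_fun_ltr.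
by apply: measurableT_comp.
Qed.

Lemma low_weight_ge0 r : 0 <= low_weight r.
Proof. by rewrite /low_weight; case: ifP => // _; exact: expR_ge0. Qed.

Definition total_spread x : \bar R :=
  (\int[leb]_r ((expR (s * r) * low_weight r)%:E * spread r x))%E.

Let mweight : measurable_fun setT (fun r => expR (s * r) * low_weight r).
Proof.
apply: measurable_funM; last exact: measurable_low_weight.
by apply: measurableT_comp => //; exact: measurable_funM.
Qed.

Let weight_ge0 r : 0 <= expR (s * r) * low_weight r.
Proof. by rewrite mulr_ge0 ?expR_ge0 ?low_weight_ge0. Qed.

Let measurable_integrand : measurable_fun setT
  (fun p : V * measurableTypeR R => ((expR (s * p.2) * low_weight p.2)%:E * spread p.2 p.1)%E).
Proof.
apply: emeasurable_funM.
  by apply/measurable_EFinP; apply: (measurableT_comp mweight); exact: measurable_snd.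
by apply: measurable_spread; [exact: measurable_snd|exact: measurable_fst].
Qed.

Lemma measurable_total_spread : measurable_fun setT total_spread.
Proof.
apply: (measurable_fun_fubini_tonelli_F (m2 := leb) _ measurable_integrand).
by move=> p; rewrite mule_ge0 ?lee_fin ?spread_ge0.
Qed.

Lemma total_spread_ge0 x : (0 <= total_spread x)%E.
Proof. by apply: integral_ge0 => r _; rewrite mule_ge0 ?lee_fin ?spread_ge0. Qed.

(** Stated for a general f to serve both the value of [spread r] at a point and its integral over
    the space. *)
Let integral_weight_le (f : R -> \bar R) : measurable_fun setT f -> (forall r, 0 <= f r)%E ->
  (forall r, f r <= (2 * M * S * decay r)%:E)%E ->
  (\int[leb]_r ((expR (s * r) * low_weight r)%:E * f r) <= (12 * M * S)%:E)%E.
Proof.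
move=> mf f0 fle.
have M0 : 0 <= M by exact: le_trans PM.
apply: (@le_trans _ _ (\int[leb]_r ((2 * M * S)%:E *
  (two_sided_expR (alpha / 2) (1 - alpha / 2) r)%:E))%E).
  apply: ge0_le_integral => //.
  - by move=> r _; rewrite mule_ge0 ?lee_fin.
  - by apply: emeasurable_funM => //; exact/measurable_EFinP.
  - by apply/measurable_EFinP; apply: measurable_funM => //; exact: measurable_two_sided_expR.
  - move=> r _; rewrite -EFinM -weight_decay.
    apply: (le_trans (lee_wpmul2l _ (fle r))); first by rewrite lee_fin.
    by rewrite -EFinM lee_fin mulrCA.
have a2 : 0 < alpha / 2 by move: alpha_ge; lra.
have a3 : 0 < 1 - alpha / 2 by move: alpha_lt1; lra.
rewrite ge0_integralZl//.
- rewrite integral_two_sided_expR// -EFinM lee_fin.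
  (* The two half-lines contribute at most 4 and 2, and [12 = 2 * (4 + 2)]. *)
  have h1 : (alpha / 2)^-1 <= 4 by rewrite invf_ple ?posrE//; move: alpha_ge; lra.
  have h2 : (1 - alpha / 2)^-1 <= 2 by rewrite invf_ple ?posrE//; move: alpha_lt1; lra.
  rewrite (_ : 12 * M * S = 2 * M * S * 6); last by ring.
  by rewrite ler_wpM2l ?mulr_ge0//; lra.
- by apply/measurable_EFinP; exact: measurable_two_sided_expR.
- by move=> r _; rewrite lee_fin two_sided_expR_ge0.
- by rewrite lee_fin !mulr_ge0.
Qed.

Lemma total_spread_le x : (total_spread x <= (12 * M * S)%:E)%E.
Proof.
apply: integral_weight_le => [|r|r]; [|exact: spread_ge0|exact: spread_le].
exact: measurable_spread.
Qed.

Lemma integral_total_spread_le : (\int[mu]_x total_spread x <= (12 * M * S)%:E)%E.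
Proof.
rewrite /total_spread (fubini_tonelli (m1 := mu) (m2 := leb) _ measurable_integrand)/=; last first.
  by move=> p; rewrite mule_ge0 ?lee_fin ?spread_ge0.
have -> : (\int[leb]_r \int[mu]_x ((expR (s * r) * low_weight r)%:E * spread r x) =
    \int[leb]_r ((expR (s * r) * low_weight r)%:E * \int[mu]_x spread r x))%E.
  apply: eq_integral => r _; rewrite ge0_integralZl//.
  - exact: measurable_spread.
  - by move=> x _; exact: spread_ge0.
  - by rewrite lee_fin.
apply: integral_weight_le => [|r|r].
- apply: (measurable_fun_fubini_tonelli_G (m1 := mu)
  (fun p : V * measurableTypeR R => spread p.2 p.1)).
    by apply: measurable_spread; [exact: measurable_snd|exact: measurable_fst].
  by move=> p; exact: spread_ge0.
- by apply: integral_ge0 => x _; exact: spread_ge0.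
- exact: integral_spread_le.
Qed.

Let kappa : R := 2 `^ alpha * pi `^ (- (n%:R / 2)) / Gamma eps.

Let s0 : 0 < s.
Proof. by case/andP: alpha01 => a0 _; rewrite /s divr_gt0// ltr_wpDl// addr_ge0// ltW. Qed.

Let kappa_ge0 : 0 <= kappa.
Proof. by rewrite divr_ge0 ?mulr_ge0 ?powR_ge0// ltW// Gamma_gt0. Qed.

(** The numerator of [frac_const] is exactly the [Gamma s] of Euler's integral; kappa is what
    remains of the constant. *)
Lemma frac_divergenceE x : frac_divergence alpha phi x =
  kappa * \int[leb]_r (expR (s * r) * gauss_incr phi x r).
Proof.
rewrite /frac_divergence /frac_const -(Gamma_frac_integral fb alpha01) [RHS]mulrA; congr (_ * _).
by rewrite mulrA [RHS]mulrAC.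
Qed.

Let mean_weight r : expR (s * r) * @gauss_mean R n r =
  if r < 0 then 0 else (Num.sqrt pi ^+ n / 2) * expR (- (eps * r)).
Proof.
rewrite /gauss_mean; case: ifP => _; first by rewrite mulr0.
by rewrite mulrCA -expRD; congr (_ * expR _); rewrite /s /eps; field.
Qed.

Let measurable_mean_weight : measurable_fun setT (fun r => expR (s * r) * @gauss_mean R n r).
Proof.
under eq_fun do rewrite mean_weight.
apply: measurable_fun_ifT => //; first exact: measurable_fun_ltr.
by apply: measurable_funM => //; do 2 (apply: measurableT_comp => //).
Qed.

Let mean_weight_ge0 r : 0 <= expR (s * r) * @gauss_mean R n r.
Proof.
by rewrite mean_weight; case: ifP.
Qed.

Let integral_mean_weight : (\int[leb]_r (expR (s * r) * @gauss_mean R n r)%:E =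
  (Num.sqrt pi ^+ n / 2 / eps)%:E)%E.
Proof.
transitivity (\int[leb]_(r in `[0%R, +oo[) ((Num.sqrt pi ^+ n / 2)%:E * (expR (- (eps * r)))%:E))%E.
  rewrite [RHS]integral_mkcond; apply: eq_integral => r _;
    rewrite mean_weight /patch mem_setE in_itv/= andbT.
  by rewrite ltNge; case: (0 <= r).
rewrite ge0_integralZl//.
- by rewrite integral_expRN.
- by apply: measurable_funTS; apply/measurable_EFinP; do 2 (apply: measurableT_comp => //).
Qed.

Let integrable_mean_weight : leb.-integrable setT (fun r => (expR (s * r) * @gauss_mean R n r)%:E).
Proof.
apply/integrableP; split; first exact/measurable_EFinP.
under eq_integral => r _ do rewrite /= ger0_norm//.
by rewrite integral_mean_weight ltry.
Qed.

Let ratio : R := 2 `^ alpha / 2 / (eps * Gamma eps).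

Let kappa_ratio : kappa * (Num.sqrt pi ^+ n / 2 / eps) = ratio.
Proof.
have -> : kappa = 2 `^ alpha * pi `^ (- (n%:R / 2)) / Gamma eps by [].
have -> : pi `^ (- (n%:R / 2)) = (Num.sqrt pi ^+ n)^-1 :> R.
  rewrite powRN; congr (_^-1); rewrite -powR12_sqrt ?pi_ge0// -powR_mulrn ?powR_ge0// -powRrM.
  by congr (_ `^ _); field.
rewrite /ratio; field.
rewrite (gt_eqF eps0) (gt_eqF (Gamma_gt0 eps0))/=.
by rewrite expf_neq0// gt_eqF// sqrtr_gt0 pi_gt0.
Qed.

Lemma frac_divergence_approx x :
  (`|frac_divergence alpha phi x - ratio * divergence phi x|%:E <=
   (kappa * ((n%:R + 1) * c))%:E * total_spread x)%E.
Proof.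
have c0 := fb_ge0 fb.
have intJ := integrable_expR_gauss_incr fb alpha01 x.
have intL := integrableZr measurableT (divergence phi x) integrable_mean_weight.
pose J r := expR (s * r) * gauss_incr phi x r - expR (s * r) * @gauss_mean R n r * divergence phi x.
have intB : leb.-integrable setT (EFin \o J) by exact: (integrableB measurableT intJ intL).
have -> : frac_divergence alpha phi x - ratio * divergence phi x = kappa * \int[leb]_r J r.
  rewrite frac_divergenceE -kappa_ratio -[kappa * _ * divergence _ _]mulrA -mulrBr; congr (_ * _).
  rewrite RintegralB// RintegralZr//; congr (_ - _ * _).
  by rewrite /Rintegral integral_mean_weight.
have mJ : measurable_fun setT J by apply/measurable_EFinP; case/integrableP : intB.
rewrite normrM (ger0_norm kappa_ge0) EFinM [(kappa * _)%:E]EFinM -muleA.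
rewrite lee_wpmul2l ?lee_fin// EFin_normr_Rintegral//.
apply: (le_trans (le_abse_integral _ _ _)) => //; first exact/measurable_EFinP.
rewrite /total_spread -ge0_integralZl//; last 3 first.
- apply: emeasurable_funM; [exact/measurable_EFinP|exact: measurable_spread].
- by move=> r _; rewrite mule_ge0 ?lee_fin ?spread_ge0.
- by rewrite lee_fin mulr_ge0// addr_ge0.
apply: ge0_le_integral => //.
- by apply: measurableT_comp => //; exact/measurable_EFinP.
- apply: emeasurable_funM => //.
  apply: emeasurable_funM; [exact/measurable_EFinP|exact: measurable_spread].
move=> r _.
have -> : J r = expR (s * r) * (gauss_incr phi x r - @gauss_mean R n r * divergence phi x).
  by rewrite /J mulrBr mulrA.
rewrite /= normrM (ger0_norm (expR_ge0 _)) EFinM.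
apply: (le_trans (lee_wpmul2l _ (gauss_incr_approx fb x r))); first by rewrite lee_fin expR_ge0.
rewrite !muleA -!EFinM.
by rewrite [expR (s * r) * ((n%:R + 1) * c * low_weight r)]mulrCA.
Qed.

Let eps_le : eps <= 1 / 4.
Proof. by rewrite /eps; move: alpha_ge; lra. Qed.

Let eps_Gamma_ge : 1 - eps <= eps * Gamma eps.
Proof.
have h := ler_wpM2l (ltW eps0) (Gamma_ge eps0).
rewrite mulrDr mulfV ?gt_eqF// in h.
have e1 : eps * (eps + 1)^-1 <= eps by rewrite ler_piMr ?(ltW eps0)// invf_le1 ?lerDr ?addr_gt0
  ?(ltW eps0).
lra.
Qed.

Let eps_Gamma_le : eps * Gamma eps <= 1 + eps * expR 4.
Proof.
have h := ler_wpM2l (ltW eps0) (Gamma_le eps0).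
rewrite mulrDr mulfV ?gt_eqF// in h; apply: (le_trans h).
(* The 4 is a crude bound for [(eps + 1)^2] when [eps <= 1/4]. *)
rewrite lerD2l ler_wpM2l ?(ltW eps0)// ler_expR expr2.
have := eps_le; have := eps0; nra.
Qed.

(** Since [eps Gamma(eps) >= 1 - eps >= 3/4], one has [1/Gamma(eps) <= 2 eps = 1 - alpha]: the pole
    of Gamma at 0 makes kappa vanish linearly. *)
Lemma kappa_le : kappa <= 2 * (1 - alpha) * pi `^ (- (n%:R / 2)).
Proof.
have a2 : 2 `^ alpha <= 2 by rewrite -[leRHS]powRr1// ler_powR ?ler1n// ltW.
have g : (Gamma eps)^-1 <= 2 * eps.
  rewrite -[leLHS]div1r ler_pdivrMr ?Gamma_gt0// -mulrA.
  by have := eps_Gamma_ge; have := eps_le; lra.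
rewrite (_ : 2 * (1 - alpha) * pi `^ (- (n%:R / 2)) = 2 * pi `^ (- (n%:R / 2)) * (2 * eps)).
  rewrite /kappa; apply: ler_pM => //; first by rewrite mulr_ge0 ?powR_ge0.
    by rewrite invr_ge0 ltW// Gamma_gt0.
  by rewrite ler_wpM2r ?powR_ge0.
by rewrite /eps; field.
Qed.

(** The ratio is [y/z] with [y = 2^(alpha-1)] and [z = eps Gamma(eps)], both within O(eps) of 1, and
    [z >= 3/4] keeps the quotient under control. *)
Lemma ratio_le : `|ratio - 1| <= (expR 4 + 2) * (1 - alpha).
Proof.
set z := eps * Gamma eps; pose y : R := 2 `^ alpha / 2.
have y1 : y <= 1.
  by rewrite /y ler_pdivrMr// mul1r -[leRHS]powRr1// ler_powR ?ler1n// ltW.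
(* By [e^u >= 1 + u] at [u = (alpha - 1) ln 2], with [ln 2 <= 1]. *)
have y2 : 1 - 2 * eps <= y.
  have -> : y = expR ((alpha - 1) * ln 2).
    rewrite /y /powR gt_eqF// mulrBl mul1r expRD expRN lnK ?posrE//.
  apply: le_trans (expR_ge1Dx _).
  have l2 : ln 2 <= 1 :> R.
    by apply: (@le_ln1Dx R 1); lra.
  rewrite /eps; move: alpha_lt1 => h; nra.
have zge : 3 / 4 <= z by have := eps_Gamma_ge; have := eps_le; rewrite -/z; lra.
have z0 : 0 < z by lra.
have e4 : 0 <= expR 4 :> R by exact: expR_ge0.
have zge' := eps_Gamma_ge; have zle' := eps_Gamma_le; rewrite -/z in zge' zle'.
have -> : ratio - 1 = (y - z) / z by rewrite /ratio -/z -/y; field; rewrite gt_eqF.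
rewrite normrM normfV (gtr0_norm z0) ler_pdivrMr//.
have yz : `|y - z| <= eps * (expR 4 + 2) by rewrite ler_norml; apply/andP; split; have := eps0; nra.
apply: (le_trans yz); rewrite (_ : 1 - alpha = 2 * eps); last by rewrite /eps; field.
have h : 0 <= (expR 4 + 2) * eps by rewrite mulr_ge0 ?(ltW eps0) ?addr_ge0.
by move: (_ * eps) h => w; nra.
Qed.

End alpha.

Lemma measurable_frac_divergence alpha : measurable_fun setT (frac_divergence alpha phi).
Proof.
apply: measurable_funM => //.
apply: (@measurable_Rintegral _ _ _ _ R mu (fun p : V * V => dot (p.2 - p.1) (phi p.2 - phi p.1)
  / enorm (p.2 - p.1) `^ (n%:R + alpha + 1))).
have mB (X Y : V * V -> V) : measurable_fun setT X -> measurable_fun setT Y ->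
    measurable_fun setT (fun p => X p - Y p).
  move=> mX mY; apply: measurable_fun_rV => i; under eq_fun do rewrite !mxE.
  by apply: measurable_funB; apply: (measurableT_comp (measurable_coord i)).
have m21 : measurable_fun setT (fun p : V * V => p.2 - p.1).
  by apply: mB; [exact: measurable_snd|exact: measurable_fst].
apply: measurable_funM.
  apply: measurable_dot => //; apply: mB; apply: (measurableT_comp (fb_measurable fb)).
    exact: measurable_snd.
  exact: measurable_fst.
under eq_fun do rewrite -powRN.
apply: (measurableT_comp (f := fun z : R => z `^ (- (n%:R + alpha + 1)))).
  exact: measurable_powR.
exact: measurable_enorm.
Qed.

(** The difference splits into the error against [ratio * divergence phi], controlled by kappa, and
    [(ratio - 1) * divergence phi]. Each is dominated pointwise by [1 - alpha] times a function
    whose supremum and integral obey the same bound, whence a single K. *)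
Lemma frac_divergence_cvg : exists K : R, forall alpha, 1 / 2 <= alpha -> alpha < 1 ->
  (forall x, `|frac_divergence alpha phi x - divergence phi x| <= K * (1 - alpha)) /\
  (\int[mu]_x `|frac_divergence alpha phi x - divergence phi x|%:E <= (K * (1 - alpha))%:E)%E.
Proof.
have c0 := fb_ge0 fb.
have M0 : 0 <= M by exact: le_trans PM.
pose k1 := 2 * pi `^ (- (n%:R / 2)) * ((n%:R + 1) * c).
pose k2 : R := expR 4 + 2.
have k10 : 0 <= k1 by rewrite !mulr_ge0 ?powR_ge0 ?addr_ge0.
have k20 : 0 <= k2 by rewrite addr_ge0 ?expR_ge0.
exists (k1 * (12 * M * S) + k2 * (c * M)) => alpha a1 a2.
have a0 : 0 <= 1 - alpha by rewrite subr_ge0 ltW.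
case: (fb_div fb) => gB _ _.
have mg := measurable_divergence fb.
have key x : (`|frac_divergence alpha phi x - divergence phi x|%:E <=
    (k1 * (1 - alpha))%:E * total_spread alpha x + (k2 * (1 - alpha))%:E *
      (c * gauss_bump B x)%:E)%E.
  have := frac_divergence_approx a1 a2 x.
  set ratio := (_ / 2 / _); set kap := (_ / _) => H.
  apply: (@le_trans _ _ (`|frac_divergence alpha phi x - ratio * divergence phi x|%:E +
     (`|ratio - 1| * `|divergence phi x|)%:E)%E).
    rewrite -EFinD lee_fin -normrM; apply: le_trans (ler_normD _ _).
    by rewrite le_eqVlt; apply/orP; left; apply/eqP; congr `| _ |; ring.
  apply: leeD.
    apply: (le_trans H); rewrite lee_wpmul2r ?total_spread_ge0// lee_fin.
    rewrite (_ : k1 * (1 - alpha) = 2 * (1 - alpha) * pi `^ (- (n%:R / 2)) * ((n%:R + 1) * c)).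
      by rewrite ler_wpM2r ?mulr_ge0 ?addr_ge0// kappa_le.
    by rewrite /k1; ring.
  by rewrite -EFinM lee_fin ler_pM// ratio_le.
have KE : (k1 * (12 * M * S) + k2 * (c * M)) * (1 - alpha) =
    k1 * (1 - alpha) * (12 * M * S) + k2 * (1 - alpha) * (c * M) by ring.
rewrite KE EFinD.
have bM x : gauss_bump B x <= M by apply: le_trans PM; exact: gauss_bump_le.
split=> [x|].
  rewrite -lee_fin; apply: (le_trans (key x)).
  rewrite EFinD; apply: leeD.
    rewrite [in leRHS]EFinM; apply: lee_wpmul2l; first by rewrite lee_fin mulr_ge0.
    exact: total_spread_le.
  by rewrite -EFinM lee_fin ler_wpM2l ?mulr_ge0// ler_wpM2l.
have hk2 : 0 <= k2 * (1 - alpha) by exact: mulr_ge0.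
have hcb x : 0 <= c * gauss_bump B x by apply: mulr_ge0 => //; exact: gauss_bump_ge0.
have mT : measurable_fun setT (total_spread alpha) by exact: measurable_total_spread.
have mb := @measurable_gauss_bump R n B.
apply: (@le_trans _ _ (\int[mu]_x ((k1 * (1 - alpha))%:E * total_spread alpha x +
  (k2 * (1 - alpha))%:E * (c * gauss_bump B x)%:E))%E).
  apply: ge0_le_integral => //.
  - apply/measurable_EFinP; apply: measurableT_comp => //; apply: measurable_funB => //.
    exact: measurable_frac_divergence.
  - apply: emeasurable_funD; first exact: emeasurable_funM.
    by apply/measurable_EFinP; apply: measurable_funM => //; exact: measurable_funM.
rewrite ge0_integralD//; last 4 first.
- by move=> x _; rewrite mule_ge0 ?total_spread_ge0// lee_fin mulr_ge0.
- exact: emeasurable_funM.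
- by move=> x _; apply: mule_ge0; rewrite lee_fin; [exact: hk2|exact: hcb].
- by apply/measurable_EFinP; apply: measurable_funM => //; exact: measurable_funM.
apply: leeD.
  rewrite ge0_integralZl//.
  - rewrite [in leRHS]EFinM; apply: lee_wpmul2l; first by rewrite lee_fin mulr_ge0.
    exact: integral_total_spread_le.
  - by move=> x _; exact: total_spread_ge0.
  - by rewrite lee_fin mulr_ge0.
rewrite (eq_integral (fun x => (k2 * (1 - alpha) * c)%:E * (gauss_bump B x)%:E)%E).
  rewrite ge0_integralZl//.
  - by rewrite [k2 * (1 - alpha) * (c * M)]mulrA [in leRHS]EFinM; apply: lee_wpmul2l;
    [rewrite lee_fin !mulr_ge0|].
  - by apply/measurable_EFinP.
  - by move=> x _; rewrite lee_fin gauss_bump_ge0.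
  - by rewrite lee_fin !mulr_ge0.
by move=> x _; rewrite -!EFinM mulrA.
Qed.

End estimate.

(** * Lower semicontinuity *)

Section lower_limit.
Context {R : realType}.
Local Open Scope ereal_scope.

Lemma le_limf_einf (u : R -> \bar R) (F : set_system R) (l : \bar R) :
  (forall e : R, (0 < e)%R -> \forall a \near F, l - e%:E <= u a) -> l <= limf_einf u F.
Proof.
move=> lu; apply/lee_subgt0Pr => e e0; rewrite limf_einfE.
have /= H := lu e e0.
apply: le_trans (ereal_sup_ubound _); last by exists (fun a => l - e%:E <= u a);
  [exact: H|reflexivity].
by apply: le_ereal_inf_tmp => _ [a /= ha <-].
Qed.

(** Integrability of u is a consequence of [u = v + (u - v)], so only the limiting integrand has to
    be integrable in advance. *)
Lemma integral_near_ge d (T : measurableType d) (mu : {measure set T -> \bar R})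
    (u v : T -> R) (e : R) : measurable_fun setT u ->
  mu.-integrable setT (EFin \o v) ->
  \int[mu]_x `|u x - v x|%:E <= e%:E ->
  \int[mu]_x (v x)%:E - e%:E <= \int[mu]_x (u x)%:E.
Proof.
move=> mu_ intv uve.
have mv : measurable_fun setT v by apply/measurable_EFinP; case/integrableP : intv.
have intw : mu.-integrable setT (EFin \o (fun x => u x - v x)%R).
  apply/integrableP; split; first by apply/measurable_EFinP; exact: measurable_funB.
  by apply: (le_lt_trans uve); rewrite ltry.
have intu : mu.-integrable setT (EFin \o u).
  have := integrableD measurableT intw intv.
  by congr (_.-integrable _ _); apply/funext => x /=; rewrite -EFinD subrK.
have -> : \int[mu]_x (u x)%:E = \int[mu]_x (v x)%:E + \int[mu]_x (u x - v x)%:E.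
  rewrite -integralD//; apply: eq_integral => x _.
  by rewrite -EFinD addrC subrK.
apply: leeD2l; rewrite leeNl.
apply: le_trans uve; apply: (@le_trans _ _ `|\int[mu]_x (u x - v x)%:E|).
  by rewrite -abseN lee_abs.
apply: (le_abse_integral mu measurableT (f := fun x => (u x - v x)%:E)).
by case/integrableP : intw.
Qed.

Lemma cvge0_near_le {T : Type} (u : T -> \bar R) (F : set_system T) (FF : Filter F) (e : R) :
  (0 < e)%R -> u a @[a --> F] --> 0 -> \forall a \near F, u a <= e%:E.
Proof.
move=> e0 /(_ [set y | y < e%:E]) H.
have : nbhs (0 : \bar R) [set y | y < e%:E].
  by apply: open_nbhs_nbhs; split; [exact: open_ereal_lt_ereal|rewrite /= lte_fin].
move=> /H; rewrite /nbhs/=; apply: (@filterS _ F FF) => a /=; exact: ltW.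
Qed.

Lemma integral_vanish_outside d (T : measurableType d) (mu : {measure set T -> \bar R})
    (K : set T) (h : T -> \bar R) :
  (forall x, ~ K x -> h x = 0) -> \int[mu]_x h x = \int[mu]_(x in K) h x.
Proof.
move=> h0; rewrite [RHS]integral_mkcond; apply: eq_integral => x _.
by rewrite /patch; case: ifPn => // /negP xK; rewrite h0// => Kx; apply: xK; rewrite inE.
Qed.

End lower_limit.

(** * Passage to the limit against a fixed test field *)

Section lower_semicontinuity.
Context {R : realType} {n : nat}.
Local Notation V := 'rV[R]_n.
Local Notation mu := (@lebesgue_measure_rV R n).
Local Open Scope ereal_scope.

(** A null measure would annihilate the Gaussian, whose integral is positive. ['N[mu]_+oo] is an
    essential supremum only when the space has positive measure. *)
Lemma lebesgue_measure_rV_gt0 : 0 < mu setT.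
Proof.
rewrite lt_neqAle measure_ge0 andbT; apply/negP => /eqP mu0.
have := @integral_gauss_rV R n 1 ltr01.
rewrite (null_set_integral (mu := mu))//.
  move=> H; have : 0 < (Num.sqrt (pi / 1) ^+ n)%:E :> \bar R.
    by rewrite lte_fin exprn_gt0// sqrtr_gt0 divr1 pi_gt0.
  by rewrite -H ltxx.
apply/measurable_EFinP; exact: measurable_gauss_rV.
Qed.

Lemma Lnorm_infty_ae (f : V -> R) (l : R) : 'N[mu]_+oo[EFin \o f] <= l%:E ->
  {ae mu, forall x, (`|f x| <= l)%R}.
Proof.
rewrite unlock /Lnorm lebesgue_measure_rV_gt0 => /ess_supP.
by apply: filterS => x /=; rewrite lee_fin.
Qed.

Lemma near_left_of_1 (e : R) : (0 < e)%R ->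
  \forall alpha \near (1%R : R)^'-, [/\ (1 / 2 <= alpha)%R, (alpha < 1)%R & (1 - alpha <= e)%R].
Proof.
move=> e0; near=> alpha; split.
- by near: alpha; apply: nbhs_left_ge; lra.
- by near: alpha; exact: nbhs_left_lt.
- have : (1 - e <= alpha)%R by near: alpha; apply: nbhs_left_ge; lra.
  lra.
Unshelve. all: by end_near. Qed.

Variables (phi : V -> V) (B c : R) (fb : field_bounds phi B c).

Let mg : measurable_fun setT (divergence phi) := measurable_divergence fb.

Let mD alpha : measurable_fun setT (frac_divergence alpha phi) := measurable_frac_divergence fb
  alpha.

Let gc x : (`|divergence phi x| <= c)%R. Proof. by case: (fb_div fb). Qed.

(** Writing D for the fractional divergence and g for the divergence,
    [F D - f g = F (D - g) + (F - f) g]. The first term is small in L^1 because F is bounded, the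
    second because g is bounded and lives on K, where F converges. *)
Lemma bounded_limit (F : R -> V -> R) (f : V -> R) (K : set V) (l : R) : compact K ->
  (forall x, ~ K x -> divergence phi x = 0%R) ->
  (forall alpha, alpha \in `]0%R, 1%R[ -> L1loc (F alpha)) -> L1loc f ->
  (forall alpha, alpha \in `]0%R, 1%R[ -> 'N[mu]_+oo[EFin \o F alpha] <= l%:E) ->
  cvg_L1loc F f ->
  \int[mu]_x (f x * divergence phi x)%:E <=
  limf_einf (fun alpha => \int[mu]_x (F alpha x * frac_divergence alpha phi x)%:E) (1%R : R)^'-.
Proof.
move=> cK gK LF [mf Lf] Fl Ff.
have [K0 KP] := frac_divergence_cvg fb.
have c0 := fb_ge0 fb.
have clK : closed K by apply: compact_closed => //; exact: norm_hausdorff.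
have mK : measurable K by exact: closed_measurable_rV.
have fK := Lf K cK.
have intfg : mu.-integrable setT (EFin \o (fun x => f x * divergence phi x)%R).
  apply/integrableP; split; first by apply/measurable_EFinP; exact: measurable_funM.
  rewrite (integral_vanish_outside mu (K := K)); last by move=> x Kx; rewrite /= gK// mulr0 normr0.
  apply: (@le_lt_trans _ _ (\int[mu]_(x in K) (c%:E * `|f x|%:E))).
    apply: ge0_le_integral => //.
    - apply: measurable_funTS; apply/measurable_EFinP.
      by apply: measurableT_comp => //; exact: measurable_funM.
    - apply: measurable_funTS; apply/measurable_EFinP.
      by apply: measurable_funM => //; exact: measurableT_comp.
    - by move=> x _; rewrite -EFinM /= lee_fin normrM mulrC ler_wpM2r.
  rewrite ge0_integralZl//; first by rewrite lte_mul_pinfty// lee_fin.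
  by apply: measurable_funTS; apply/measurable_EFinP; exact: measurableT_comp.
apply: le_limf_einf => e e0.
(* Each term receives [e/2]. The absolute values are there because l and K0 have no known sign, the
   [+ 1] because the factors may be 0. *)
pose e1 := (e / 2 / (`|l| * `|K0| + 1))%R; pose e2 := (e / 2 / (c + 1))%R.
have A1 : (0 < `|l| * `|K0| + 1)%R by rewrite ltr_wpDl ?mulr_ge0.
have c1 : (0 < c + 1)%R by rewrite ltr_wpDl.
have e10 : (0 < e1)%R by rewrite !divr_gt0.
have e20 : (0 < e2)%R by rewrite !divr_gt0.
near=> alpha.
have [a1 a2 a3] : [/\ (1 / 2 <= alpha)%R, (alpha < 1)%R & (1 - alpha <= e1)%R].
  by near: alpha; exact: near_left_of_1.
have FfK : \int[mu]_(x in K) `|F alpha x - f x|%:E <= e2%:E.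
  by near: alpha; apply: cvge0_near_le => //; exact: Ff.
have a01 : alpha \in `]0%R, 1%R[ by rewrite in_itv/= a2 andbT; lra.
have [mF _] := LF _ a01.
have Fae := Lnorm_infty_ae (Fl _ a01).
have [_ DL1] := KP _ a1 a2.
have mFf : measurable_fun setT (fun x => `|F alpha x - f x|)%R.
  by apply: measurableT_comp => //; exact: measurable_funB.
have mDg : measurable_fun setT (fun x => `|frac_divergence alpha phi x - divergence phi x|)%R.
  by apply: measurableT_comp => //; apply: measurable_funB => //; exact: mD.
have mag : measurable_fun setT (fun x => `|divergence phi x|)%R by exact: measurableT_comp.
apply: integral_near_ge => //; first by apply: measurable_funM => //; exact: mD.
apply: (@le_trans _ _ (\int[mu]_x (`|l|%:E * `|frac_divergence alpha phi x - divergence phi x|%:E +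
    (`|F alpha x - f x| * `|divergence phi x|)%:E))).
  apply: ae_ge0_le_integral => //.
  - apply/measurable_EFinP; apply: measurableT_comp => //.
    apply: measurable_funB; last exact: measurable_funM.
    by apply: measurable_funM => //; exact: mD.
  - by move=> x _; rewrite -EFinM -EFinD lee_fin addr_ge0// mulr_ge0.
  - apply: emeasurable_funD; apply/measurable_EFinP; last exact: measurable_funM.
    exact: measurable_funM.
  - apply: filterS Fae => x Fx _; rewrite -EFinM -EFinD lee_fin.
    rewrite (_ : (F alpha x * frac_divergence alpha phi x - f x * divergence phi x =
      F alpha x * (frac_divergence alpha phi x - divergence phi x) +
      (F alpha x - f x) * divergence phi x)%R); last by ring.
    apply: (le_trans (ler_normD _ _)); rewrite !normrM lerD2r ler_wpM2r//.
    exact: le_trans (ler_norm l).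
rewrite ge0_integralD//; last 2 first.
- by apply/measurable_EFinP; exact: measurable_funM.
- by apply/measurable_EFinP; exact: measurable_funM.
rewrite ge0_integralZl//; last exact/measurable_EFinP.
rewrite (integral_vanish_outside mu (K := K) (h := fun x =>
  (`|F alpha x - f x| * `|divergence phi x|)%:E)); last first.
  by move=> x Kx; rewrite gK// normr0 mulr0.
apply: (@le_trans _ _ (`|l|%:E * (K0 * (1 - alpha))%:E + c%:E * e2%:E)).
  apply: leeD; first by rewrite lee_wpmul2l// lee_fin.
  apply: (@le_trans _ _ (\int[mu]_(x in K) (c%:E * `|F alpha x - f x|%:E))).
    apply: ge0_le_integral => //.
    - by apply: measurable_funTS; apply/measurable_EFinP; exact: measurable_funM.
    - by apply: measurable_funTS; apply/measurable_EFinP; exact: measurable_funM.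
    - by move=> x _; rewrite -EFinM lee_fin mulrC ler_wpM2r.
  rewrite ge0_integralZl//; first by rewrite lee_wpmul2l// lee_fin.
  by apply: measurable_funTS; apply/measurable_EFinP.
rewrite -!EFinM -EFinD lee_fin.
have h1 : (`|l| * (K0 * (1 - alpha)) <= e / 2)%R.
  apply: (@le_trans _ _ ((`|l| * `|K0| + 1) * e1)%R).
    rewrite mulrA; apply: (@le_trans _ _ ((`|l| * `|K0|) * (1 - alpha))%R).
      by rewrite ler_wpM2r ?subr_ge0 ?(ltW a2)// ler_wpM2l ?ler_norm.
    apply: ler_pM => //; last by rewrite lerDl.
    by rewrite subr_ge0 ltW.
  by rewrite /e1 mulrC divfK// gt_eqF.
have h2 : (c * e2 <= e / 2)%R.
  apply: (@le_trans _ _ ((c + 1) * e2)%R).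
    by rewrite ler_wpM2r ?(ltW e20)// lerDl.
  by rewrite /e2 mulrC divfK// gt_eqF.
by lra.
Unshelve. all: by end_near. Qed.

(** The splitting is now [D (F - f) + (D - g) f], with D the fractional divergence and g the
    divergence. D is not confined to a compact set, so its uniform bound [c + |K0|] meets the global
    L^1 convergence of F, while the uniform smallness of [D - g] meets the integrable f. *)
Lemma integrable_limit (F : R -> V -> R) (f : V -> R) :
  (forall alpha, alpha \in `]0%R, 1%R[ -> L1 (F alpha)) -> L1 f -> cvg_L1 F f ->
  \int[mu]_x (f x * divergence phi x)%:E <=
  limf_einf (fun alpha => \int[mu]_x (F alpha x * frac_divergence alpha phi x)%:E) (1%R : R)^'-.
Proof.
move=> LF Lf Ff.
have [K0 KP] := frac_divergence_cvg fb.
have c0 := fb_ge0 fb.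
have mf : measurable_fun setT f by apply/measurable_EFinP; case/integrableP : Lf.
have maf : measurable_fun setT (fun x => `|f x|)%R by exact: measurableT_comp.
have [m m0 fm] : exists2 m : R, (0 <= m)%R & \int[mu]_x `|f x|%:E = m%:E.
  exists (fine (\int[mu]_x `|f x|%:E)); first by apply: fine_ge0; exact: integral_ge0.
  rewrite fineK// ge0_fin_numE; last exact: integral_ge0.
  by case/integrableP : Lf.
have intfg : mu.-integrable setT (EFin \o (fun x => f x * divergence phi x)%R).
  apply/integrableP; split; first by apply/measurable_EFinP; exact: measurable_funM.
  apply: (@le_lt_trans _ _ (\int[mu]_x (c%:E * `|f x|%:E))).
    apply: ge0_le_integral => //.
    - apply/measurable_EFinP.
      by apply: measurableT_comp => //; exact: measurable_funM.
    - apply/measurable_EFinP.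
      by apply: measurable_funM => //; exact: measurableT_comp.
    - by move=> x _; rewrite -EFinM /= lee_fin normrM mulrC ler_wpM2r.
  rewrite ge0_integralZl//; first by rewrite fm -EFinM ltry.
  exact/measurable_EFinP.
apply: le_limf_einf => e e0.
have A1 : (0 < `|K0| * m + 1)%R by rewrite ltr_wpDl ?mulr_ge0.
have c1 : (0 < c + `|K0| + 1)%R by rewrite ltr_wpDl ?addr_ge0.
pose e1 := (e / 2 / (`|K0| * m + 1))%R; pose e2 := (e / 2 / (c + `|K0| + 1))%R.
have e10 : (0 < e1)%R by rewrite !divr_gt0.
have e20 : (0 < e2)%R by rewrite !divr_gt0.
near=> alpha.
have [a1 a2 a3] : [/\ (1 / 2 <= alpha)%R, (alpha < 1)%R & (1 - alpha <= e1)%R].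
  by near: alpha; exact: near_left_of_1.
have FfL : \int[mu]_x `|F alpha x - f x|%:E <= e2%:E.
  rewrite -(Lnorm1 mu (fun x => (F alpha x - f x)%:E)).
  by near: alpha; apply: cvge0_near_le => //; exact: Ff.
have a01 : alpha \in `]0%R, 1%R[ by rewrite in_itv/= a2 andbT; lra.
have mF : measurable_fun setT (F alpha) by apply/measurable_EFinP; case/integrableP : (LF _ a01).
have [Dsup _] := KP _ a1 a2.
have mFf : measurable_fun setT (fun x => `|F alpha x - f x|)%R.
  by apply: measurableT_comp => //; exact: measurable_funB.
have K1 : (K0 * (1 - alpha) <= `|K0| * (1 - alpha))%R by rewrite ler_wpM2r ?ler_norm// subr_ge0 ltW.
have Dbound x : (`|frac_divergence alpha phi x| <= c + `|K0|)%R.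
  rewrite -[X in `|X|%R](subrK (divergence phi x)) addrC.
  apply: (le_trans (ler_normD _ _)); apply: lerD => //; apply: (le_trans (Dsup x)).
  by apply: (le_trans K1); rewrite ler_piMr//; lra.
apply: integral_near_ge => //; first by apply: measurable_funM => //; exact: mD.
apply: (@le_trans _ _ (\int[mu]_x ((c + `|K0|)%:E * `|F alpha x - f x|%:E +
    (`|K0| * (1 - alpha))%:E * `|f x|%:E))).
  apply: ge0_le_integral => //.
  - apply/measurable_EFinP; apply: measurableT_comp => //.
    apply: measurable_funB; last exact: measurable_funM.
    by apply: measurable_funM => //; exact: mD.
  - by apply: emeasurable_funD; apply/measurable_EFinP; exact: measurable_funM.
  - move=> x _; rewrite -!EFinM -EFinD lee_fin.
    rewrite (_ : (F alpha x * frac_divergence alpha phi x - f x * divergence phi x =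
      frac_divergence alpha phi x * (F alpha x - f x) +
      (frac_divergence alpha phi x - divergence phi x) * f x)%R); last by ring.
    apply: (le_trans (ler_normD _ _)); rewrite [X in (X + _ <= _)%R]normrM
      [X in (_ + X <= _)%R]normrM.
    by apply: lerD; rewrite ler_wpM2r//; apply: le_trans (Dsup x) K1.
have k0 : (0 <= `|K0| * (1 - alpha))%R by rewrite mulr_ge0// subr_ge0 ltW.
have k1 : (0 <= c + `|K0|)%R by rewrite addr_ge0.
rewrite ge0_integralD//; last 4 first.
- by move=> x _; rewrite -EFinM lee_fin mulr_ge0.
- by apply/measurable_EFinP; exact: measurable_funM.
- by move=> x _; rewrite -EFinM lee_fin mulr_ge0.
- by apply/measurable_EFinP; exact: measurable_funM.
rewrite ge0_integralZl//; [|exact/measurable_EFinP].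
rewrite ge0_integralZl//; [|exact/measurable_EFinP].
rewrite fm; apply: (@le_trans _ _ ((c + `|K0|)%:E * e2%:E + (`|K0| * (1 - alpha))%:E * m%:E)).
  by apply: leeD => //; rewrite lee_wpmul2l// lee_fin.
rewrite -!EFinM -EFinD lee_fin.
have h1 : (`|K0| * (1 - alpha) * m <= e / 2)%R.
  apply: (@le_trans _ _ ((`|K0| * m + 1) * e1)%R).
    rewrite mulrAC; apply: ler_pM => //; last by rewrite lerDl.
      by rewrite mulr_ge0.
    by rewrite subr_ge0 ltW.
  by rewrite /e1 mulrC divfK// gt_eqF.
have h2 : ((c + `|K0|) * e2 <= e / 2)%R.
  apply: (@le_trans _ _ ((c + `|K0| + 1) * e2)%R).
    by rewrite ler_wpM2r ?(ltW e20)// lerDl.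
  by rewrite /e2 mulrC divfK// gt_eqF.
by lra.
Unshelve. all: by end_near. Qed.

End lower_semicontinuity.

Local Open Scope ereal_scope.

Theorem theorem4p13 (R : realType) (n : nat) (n_gt0 : (0 < n)%N)
    (Omega : set 'rV[R]_n) (oOmega : open Omega) :
  (forall (F : R -> 'rV[R]_n -> R) (f : 'rV[R]_n -> R),
     (forall alpha : R, alpha \in `]0%R, 1%R[ -> L1loc (F alpha)) ->
     L1loc f ->
     ereal_sup [set 'N[lebesgue_measure_rV n]_+oo[EFin \o F alpha]
               | alpha in `]0%R, 1%R[] < +oo ->
     cvg_L1loc F f ->
     div_variation f Omega <=
       limf_einf (fun alpha => frac_variation alpha (F alpha) Omega)
                 (1%R : R)^'-)
  /\
  (forall (F : R -> 'rV[R]_n -> R) (f : 'rV[R]_n -> R),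
     (forall alpha : R, alpha \in `]0%R, 1%R[ -> L1 (F alpha)) ->
     L1 f ->
     cvg_L1 F f ->
     div_variation f Omega <=
       limf_einf (fun alpha => frac_variation alpha (F alpha) Omega)
                 (1%R : R)^'-).
Proof.
have liminf_le (u v : R -> \bar R) : (forall a, u a <= v a)%E ->
    (limf_einf u (1%R : R)^'- <= limf_einf v (1%R : R)^'-)%E.
  move=> uv; rewrite !limf_einfE; apply: ge_ereal_sup => _ [A FA <-].
  apply: (@le_trans _ _ (ereal_inf (v @` A))); last by apply: ereal_sup_ubound; exists A.
  apply: le_ereal_inf_tmp => _ [a Aa <-].
  by apply: le_trans (uv a); apply: ereal_inf_lbound; exists a.
split=> F f HF Hf.
  move=> Fsup Ff; apply: ge_ereal_sup => _ [phi phiO <-].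
  have [Cphi _] := phiO; have [B [c fb]] := Cinfty_c_field_bounds Cphi.
  have [l lP] : exists l : R, (ereal_sup [set 'N[lebesgue_measure_rV n]_+oo[EFin \o F alpha]
               | alpha in `]0%R, 1%R[] <= l%:E)%E.
    (* An extended supremum below [+oo] is real or, formally, [-oo]; in the latter case 0 serves as
       the bound. *)
    by move: Fsup; case: (ereal_sup _) => [l _|//|_]; [exists l|exists 0%R; rewrite leNye].
  apply: (le_trans (bounded_limit (K := supp phi) (l := l) fb _ _ HF Hf _ Ff)).
  - by case: Cphi.
  - move=> x Kx; rewrite /divergence big1// => i _.
    apply: (partial_eq0 i (K := supp phi)) => //; first exact: closed_closure.
    move=> y Ky; apply/eqP/negPn/negP => py; apply: Ky; apply: subset_closure => /=.
    by apply: contraNneq py => ->; rewrite mxE.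
  - by move=> alpha a01; apply: le_trans lP; apply: ereal_sup_ubound; exists alpha.
  - apply: liminf_le => alpha; apply: ereal_sup_ubound; by exists phi.
move=> Ff; apply: ge_ereal_sup => _ [phi phiO <-].
have [Cphi _] := phiO; have [B [c fb]] := Cinfty_c_field_bounds Cphi.
apply: (le_trans (integrable_limit fb HF Hf Ff)).
apply: liminf_le => alpha; apply: ereal_sup_ubound; by exists phi.
Qed.
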